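(* Let $d\ge 3$. Assume that $\inf_{t}V''(t)=c_->0$ and let the $\eta_i$ be symmetrically distributed, i.i.d. with finite second moment. Then there exist dimension-dependent constants $C_1,C_2>0$, independent of the distribution of the disorder, such that, for all $\varepsilon$ and for all volumes $\Lambda$, the disorder average of the fraction of pinned sites obeys the estimate $$\frac{1}{|\Lambda|}\sum_{i\in\Lambda}\mathbb{E}\Bigl(\mu_{\varepsilon,\Lambda}[\eta](\phi_i=0)\Bigr)\ \ge\ 1-\frac{C_1+C_2\,\mathbb{E}(\eta_0^2)}{\log\varepsilon}.$$
   Context: $V:\mathbb{R}\to\mathbb{R}$ is a pair potential. For a finite set (volume) $\Lambda\subset\mathbb{Z}^d$, pinning strength $\varepsilon$, and a fixed configuration $\eta=(\eta_i)_{i\in\mathbb{Z}^d}$ of real external fields (the disorder), $\mu_{\varepsilon,\Lambda}[\eta]$ is the quenched finite-volume Gibbs measure with zero boundary condition, i.e. the probability measure for the variables $\phi_\Lambda=(\phi_i)_{i\in\Lambda}\in\mathbb{R}^\Lambda$ given by $$\mu_{\varepsilon,\Lambda}[\eta](d\phi_\Lambda)=\frac{1}{Z_{\varepsilon,\Lambda}[\eta]}\exp\Bigl(-\frac1{4d}\sum_{\langle i,j\rangle\in\Lambda}V(\phi_i-\phi_j)-\frac1{4d}\sum_{i\in\Lambda,\,j\in\Lambda^c,\,|i-j|=1}V(\phi_i)+\sum_{i\in\Lambda}\eta_i\phi_i\Bigr)\prod_{i\in\Lambda}\bigl(d\phi_i+\varepsilon\,\delta_0(d\phi_i)\bigr),$$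 where the first sum runs over nearest-neighbor pairs in $\Lambda$, $\Lambda^c=\mathbb{Z}^d\setminus\Lambda$, $d\phi_i$ is Lebesgue measure, $\delta_0$ is the Dirac measure at $0$, and $Z_{\varepsilon,\Lambda}[\eta]$ is the normalizing constant (partition function). $\mu_{\varepsilon,\Lambda}[\eta](\phi_i=0)$ is the probability of the event $\{\phi_i=0\}$ (site $i$ is pinned). $\mathbb{E}$ is the expectation over the random fields $\eta$.
   Formalization: Proved for ε > 1 only: for 0 < ε < 1 the right side exceeds 1, so the bound is false, and at ε = 0, 1 it is undefined. C₁, C₂ may depend on c₋ and V′(0) (zero for even V) besides d; dependence on c₋ is unavoidable. *)

(* Defs.v *)
From HB Require Import structures.
From mathcomp Require Import all_boot all_order all_algebra finmap.
From mathcomp Require Import all_classical all_reals all_analysis.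
Set Implicit Arguments.
Unset Strict Implicit.
Unset Printing Implicit Defensive.
Import Order.TTheory GRing.Theory Num.Theory.
Import numFieldNormedType.Exports.
Local Open Scope classical_set_scope.
Local Open Scope ring_scope.

Section SiteMeasure.
Variables (R : realType) (eps : {nonneg R}).

(* d phi + eps * delta_0(d phi) *)
Definition site_measure : set (measurableTypeR R) -> \bar R :=
  measure_add (@lebesgue_measure R)
              (mscale eps (dirac (0 : measurableTypeR R))).

HB.instance Definition _ := Measure.on site_measure.

Lemma site_measure_sigma_finite : sigma_finite setT site_measure.
Proof.
have [F FT Foo] := sigma_finiteT (@lebesgue_measure R).
exists F => // n; have [mF Fn] := Foo n; split => //.
have -> : site_measure (F n) =
    (lebesgue_measure (F n) + eps%:num%:E * dirac (0%R : measurableTypeR R) (F n))%E.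
  exact: measure_addE.
by rewrite diracE -EFinM lte_add_pinfty// ltry.
Qed.

HB.instance Definition _ :=
  Measure_isSigmaFinite.Build _ _ _ site_measure site_measure_sigma_finite.

Definition tuple_push (n : nat)
    (z : n.-tuple (measurableTypeR R) * measurableTypeR R) :
    n.+1.-tuple (measurableTypeR R) := [tuple of z.2 :: z.1].

Lemma measurable_tuple_push n : measurable_fun setT (@tuple_push n).
Proof. exact: measurable_cons. Qed.

Section AddSite.
Variables (n : nat) (m : {measure set (n.-tuple (measurableTypeR R)) -> \bar R}).

Definition add_site : set (n.+1.-tuple (measurableTypeR R)) -> \bar R :=
  pushforward (m \x site_measure)%E (@tuple_push n).

HB.instance Definition _ := Measure.copy add_site
  (measure_function_pushforward__canonical__measure_function_Measure
     (m \x site_measure)%E (@measurable_tuple_push n)).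

End AddSite.

Fixpoint product_site_measure (n : nat) :
    {measure set (n.-tuple (measurableTypeR R)) -> \bar R} :=
  match n with
  | 0 => dirac [tuple]
  | m.+1 => add_site (product_site_measure m)
  end.

Lemma product_site_measureE n (A : 'I_n -> set (measurableTypeR R)) :
  (forall i, measurable (A i)) ->
  product_site_measure n [set t | forall i, A i (tnth t i)] =
  (\prod_(i < n) site_measure (A i))%E.
Proof.
elim: n A => [|n IHn] A mA.
  rewrite big_ord0 /= diracE mem_set//.
  by case.
rewrite big_ord_recl muleC.
pose B := [set t : n.-tuple (measurableTypeR R) |
  forall i, A (lift ord0 i) (tnth t i)].
have mB : measurable B.
  have -> : B = \bigcap_(i in [set: 'I_n])
      ((fun t => tnth t i) @^-1` A (lift ord0 i)).
    by apply/seteqP; split => [t Bt i _|t Bt i]; [exact: Bt|exact: (Bt i I)].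
  apply: fin_bigcap_measurable => // i _.
  rewrite -[X in measurable X]setTI.
  exact: (@measurable_tnth _ (measurableTypeR R) n i).
rewrite -(IHn (fun i => A (lift ord0 i)))//.
transitivity ((product_site_measure n \x site_measure)%E (B `*` A ord0)).
  2: exact: product_measure1E.
rewrite /= /add_site /pushforward; congr (product_measure1 _ _ _).
apply/seteqP; split => -[t x] /=.
  move=> h; split => [i|].
    by have := h (lift ord0 i); rewrite tnthS.
  by have := h ord0; rewrite tnth0.
move=> [ht hx] i; case: (unliftP ord0 i) => [j ->|->].
  by rewrite tnthS; exact: ht.
by rewrite tnth0.
Qed.

End SiteMeasure.

(* The 2d sites y with |x - y| = 1. *)
Definition neighbours (d : nat) (x : 'rV[int]_d) : seq 'rV[int]_d :=
  [seq x + delta_mx 0 k | k <- enum 'I_d] ++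
  [seq x - delta_mx 0 k | k <- enum 'I_d].

Section GibbsMeasure.
Variables (R : realType) (d : nat) (L : {fset 'rV[int]_d}).

(* A configuration on L is a tuple listing the heights along the enumeration
   of L; [height] reads it as a function on Z^d, with value 0 off L. *)
Definition config : Type := #|` L|.-tuple (measurableTypeR R).

Definition height (phi : config) (x : 'rV[int]_d) : R :=
  nth 0 phi (index x (enum_fset L)).

Variable V : R -> R.

(* The double sum visits each unordered pair {x, y} twice, as (x, y) and as
   (y, x), whence the factor 1/2; for even V this is the sum of V(phi_x - phi_y)
   over unordered pairs. *)
Definition bulk_energy (phi : config) : R :=
  2^-1 * \sum_(x <- L) \sum_(y <- neighbours x | y \in L)
           V (height phi x - height phi y).

Definition boundary_energy (phi : config) : R :=
  \sum_(x <- L) \sum_(y <- neighbours x | y \notin L) V (height phi x).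

Definition gibbs_weight (eta : 'rV[int]_d -> R) (phi : config) : R :=
  expR (- (4 * d%:R)^-1 * bulk_energy phi
        - (4 * d%:R)^-1 * boundary_energy phi
        + \sum_(x <- L) eta x * height phi x).

Definition gibbs_mass (eps : {nonneg R}) (eta : 'rV[int]_d -> R)
    (A : set config) : \bar R :=
  (\int[product_site_measure eps #|` L|]_(phi in A)
     (gibbs_weight eta phi)%:E)%E.

Definition partition_function (eps : {nonneg R}) (eta : 'rV[int]_d -> R) :
    \bar R := gibbs_mass eps eta setT.

(* When inf V'' > 0, both masses are finite and the partition function is
   positive, so that [fine] loses nothing. *)
Definition gibbs (eps : {nonneg R}) (eta : 'rV[int]_d -> R)
    (A : set config) : R :=
  fine (gibbs_mass eps eta A) / fine (partition_function eps eta).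

Definition pinned (x : 'rV[int]_d) : set config :=
  [set phi | height phi x = 0].

End GibbsMeasure.
Arguments gibbs {R d} L V eps eta A.
Arguments pinned R {d} L x.

Section RandomFields.
Context {dO : measure_display} {Omega : measurableType dO} {R : realType}.
Context {P : probability Omega R} {I : choiceType}.
Variable X : I -> {RV P >-> R}.

Definition mutually_independent : Prop :=
  forall (J : {fset I}) (A : I -> set R), (forall i, measurable (A i)) ->
    P (\bigcap_(i in [set` J]) (X i @^-1` A i)) =
    (\prod_(i <- J) P (X i @^-1` A i))%E.

Definition identically_distributed : Prop :=
  forall (i j : I) (A : set R), measurable A ->
    distribution P (X i) A = distribution P (X j) A.

Definition symmetrically_distributed : Prop :=
  forall (i : I) (A : set R), measurable A ->
    distribution P (X i) (-%R @^-1` A) = distribution P (X i) A.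

End RandomFields.

(* Main.v *)
(* Comparing the measure at strength eps > 1 with the one at strength 1: the
   ratio Z_1 / Z_eps is the Gibbs expectation of eps^(-N), N being the number of
   pinned sites, so Jensen gives  log eps * <N> >= log Z_eps - log Z_1.  The all
   pinned configuration yields  Z_eps >= exp(-H(0)) eps^|L|.

   Upper bound on Z_1.  H is strongly convex with respect to the Dirichlet form,
   and in d >= 3 transience gives  phi_x^2 <= 2 D(phi).  Integrating the sites out
   one at a time then costs a constant factor per site, whence
   Z_1 <= K^|L| exp(- inf H).

   Disorder.  Transience is realised by an explicit flow theta_x of energy at
   most 2 from x to infinity (the Polya urn walk in the positive octant).  As
   phi_x = sum_e theta_x(e) grad phi(e), completing the square gives
     inf H >= H(0) - const |L| - const * sum_e (sum_x eta_x theta_x(e))^2,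
   and by orthogonality of the eta_x the last sum has expectation
   E(eta_0^2) * sum_x (energy of theta_x) <= 2 |L| E(eta_0^2). *)

Require Import Defs.
From HB Require Import structures.
From mathcomp Require Import all_boot all_order all_algebra finmap.
From mathcomp Require Import all_classical all_reals all_analysis.
From mathcomp Require Import measurable_realfun.
From mathcomp Require Import ring lra zify.
Import Order.TTheory GRing.Theory Num.Theory.
Import numFieldNormedType.Exports.
Local Open Scope classical_set_scope.
Local Open Scope ring_scope.
Set Implicit Arguments.
Unset Strict Implicit.
Unset Printing Implicit Defensive.

(** * A unit flow of finite energy *)

Section UrnFlow.
Variables (R : realType) (d : nat).
Hypothesis d_gt0 : (0 < d)%N.
Implicit Types (a x z : 'rV[int]_d) (B L : {fset 'rV[int]_d}).

Definition unit_step (k : 'I_d) : 'rV[int]_d := delta_mx 0 k.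

Definition octant a : bool := [forall k, 0 <= a 0 k].

Definition level a : nat := (\sum_k absz (a 0%R k))%N.

(* Polya urn: each step adds to a colour with probability proportional to its
   count, which makes the walk uniform on every level; [urn n] is the common
   probability 1 / 'C(n + d - 1, d - 1) of a site of level [n]. *)
Definition urn (n : nat) : R := \prod_(j < n) (j.+1%:R / (j + d)%:R).

(** Expected flux of the urn walk through an edge: the site probability times the transition
    probability [(a_k + 1) / (level a + d)] of an urn started with one ball of each colour. *)
Definition flow a (k : 'I_d) : R :=
  if octant a then urn (level a) * (absz (a 0 k)).+1%:R / (level a + d)%:R else 0.

Lemma urnS n : urn n.+1 = urn n * (n.+1%:R / (n + d)%:R).
Proof. by rewrite /urn big_ord_recr. Qed.

Lemma urn_ge0 n : 0 <= urn n.
Proof. by apply: prodr_ge0 => i _; rewrite divr_ge0. Qed.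

Lemma flow_ge0 a k : 0 <= flow a k.
Proof.
rewrite /flow; case: ifP => // _.
by rewrite divr_ge0// mulr_ge0// urn_ge0.
Qed.

Lemma absz_step a k j : 0 <= a 0 j ->
  absz ((a + unit_step k) 0 j) = (absz (a 0%R j) + (j == k))%N.
Proof. by rewrite !mxE eqxx /=; case: (j == k) => /=; lia. Qed.

Lemma level_step a k : octant a -> level (a + unit_step k) = (level a).+1.
Proof.
move=> /forallP a0; rewrite /level.
under eq_bigr do rewrite absz_step//.
rewrite big_split/= [X in addn _ X](bigD1 k)//= eqxx.
by rewrite [X in (_ + (_ + X))%N]big1 ?addn1// => j /negbTE->.
Qed.

Lemma octant_step a k : octant a -> octant (a + unit_step k).
Proof.
move=> /forallP a0; apply/forallP => j; have := a0 j.
by rewrite !mxE eqxx/=; case: (j == k) => /=; lia.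
Qed.

Lemma octant_unstep a k : octant (a - unit_step k) = octant a && (a 0 k != 0).
Proof.
apply/forallP/andP => [h|[/forallP h ak] j].
  split; last by have := h k; rewrite !mxE !eqxx/=; lia.
  apply/forallP => j; have := h j.
  by rewrite !mxE eqxx/=; case: (j == k) => /=; lia.
rewrite !mxE eqxx/=; have := h j.
by case: (eqVneq j k) ak => [->|] /=; lia.
Qed.

Lemma level_eq0 a : (level a == 0)%N = (a == 0).
Proof.
apply/idP/eqP => [|->]; last by rewrite /level big1// => k _; rewrite mxE.
rewrite /level sum_nat_eq0 => /forallP h; apply/rowP => k; rewrite mxE.
by have := h k => /=; rewrite absz_eq0 => /eqP.
Qed.

Lemma flow_out a : \sum_k flow a k = if octant a then urn (level a) else 0.
Proof.
rewrite /flow; case: ifP => _; last by rewrite big1.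
rewrite -mulr_suml -mulr_sumr -natr_sum.
under eq_bigr do rewrite -addn1.
rewrite big_split/= sum_nat_const card_ord muln1 -mulrA divff ?mulr1//.
by rewrite pnatr_eq0 -/(level a); lia.
Qed.

(** Uniformity propagates: the predecessor along [k] sends [urn n * a_k / (n + d)], and the
    coordinates add up to [n + 1], which is the recursion for [urn]. *)
Lemma flow_in a : octant a -> a != 0 ->
  \sum_k flow (a - unit_step k) k = urn (level a).
Proof.
move=> oa; rewrite -level_eq0.
case E : (level a) => [//|n] _.
have -> : \sum_k flow (a - unit_step k) k =
    \sum_k (urn n * (absz (a 0 k))%:R / (n + d)%:R).
  apply: eq_bigr => k _; rewrite /flow octant_unstep oa/=.
  have [-> |ak] := eqVneq (a 0 k) 0; first by rewrite mulr0 mul0r.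
  have oak : octant (a - unit_step k) by rewrite octant_unstep oa.
  have := level_step k oak; rewrite subrK E => -[<-].
  have /forallP/(_ k) h := oak.
  have := absz_step k h; rewrite subrK eqxx addn1 => <- //.
rewrite -mulr_suml -mulr_sumr -natr_sum -/(level a) E urnS.
by rewrite mulrA.
Qed.

(** Kirchhoff's law with a unit source at the origin. Off the octant nothing flows in, since a
    predecessor in the octant would put [a] there too. *)
Lemma flow_divergence a :
  \sum_k flow a k - \sum_k flow (a - unit_step k) k = (a == 0)%:R.
Proof.
rewrite flow_out; case: (boolP (octant a)) => oa.
  have [->|a0] := eqVneq a 0; last by rewrite flow_in// subrr.
  rewrite big1 ?subr0 => [|k _].
    have /eqP -> : level 0 == 0%N by rewrite level_eq0.
    by rewrite /urn big_ord0.
  by rewrite /flow octant_unstep mxE eqxx andbF.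
rewrite big1 ?subrr => [|k _].
  by case: eqVneq oa => // ->; case/negP; apply/forallP => k; rewrite mxE.
by rewrite /flow octant_unstep (negbTE oa).
Qed.

(** * Summation by parts against the flow *)

Section Support.
Variables (phi : 'rV[int]_d -> R) (B : {fset 'rV[int]_d}).
Hypothesis suppB : forall z, phi z != 0 ->
  z \in B /\ forall k, z - unit_step k \in B.

(** [B] contains the support of [phi] and its backward neighbours, so the translated sum loses no
    nonzero term. *)
Lemma sum_shift (k : 'I_d) (f : 'rV[int]_d -> R) :
  \sum_(z <- B) f z * phi (z + unit_step k) =
  \sum_(z <- B) f (z - unit_step k) * phi z.
Proof.
pose S := [fset z in B | phi z != 0]%fset.
pose T := [fset z - unit_step k | z in S]%fset.
have SB : (S `<=` B)%fset by apply/fsubsetP => z; rewrite !inE => /andP[].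
have TB : (T `<=` B)%fset.
  apply/fsubsetP => _ /imfsetP[z /= zS ->]; move: zS.
  by rewrite !inE => /andP[_ /suppB[_]].
transitivity (\sum_(z <- T) f z * phi (z + unit_step k)).
  apply/esym/big_fset_incl => // z zB zT.
  have [->|nz] := eqVneq (phi (z + unit_step k)) 0; first by rewrite mulr0.
  case/negP: zT; apply/imfsetP; exists (z + unit_step k) => /=.
    by rewrite !inE nz andbT; case: (suppB nz).
  by rewrite addrK.
transitivity (\sum_(z <- S) f (z - unit_step k) * phi z); last first.
  apply: big_fset_incl => // z zB.
  by rewrite !inE zB/= negbK => /eqP ->; rewrite mulr0.
rewrite /T big_imfset/=; last by move=> x y _ _ /addIr.
by apply: eq_bigr => z _; rewrite subrK.
Qed.

(** The flow out of [x] has divergence the indicator of [x]; moving the gradient off [phi] by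
    summation by parts returns [phi x]. *)
Lemma flow_representation x :
  phi x = \sum_(z <- B) \sum_k flow (z - x) k * (phi z - phi (z + unit_step k)).
Proof.
transitivity (\sum_(z <- B) (z == x)%:R * phi z); last first.
  transitivity (\sum_(z <- B) \sum_k flow (z - x) k * phi z -
      \sum_(z <- B) \sum_k flow (z - x) k * phi (z + unit_step k)); last first.
    rewrite -sumrB; apply: eq_bigr => z _; rewrite -sumrB.
    by apply: eq_bigr => k _; rewrite mulrBr.
  rewrite [in X in _ = _ - X]exchange_big/=.
  under [in X in _ = _ - X]eq_bigr do rewrite (sum_shift _ (fun z => flow (z - x) _)).
  rewrite [in X in _ = _ - X]exchange_big/= -sumrB; apply: eq_bigr => z _.
  rewrite -!mulr_suml -mulrBl -subr_eq0 -flow_divergence.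
  by under [in X in _ = (_ - X) * _]eq_bigr do rewrite addrAC.
have [xB|xB] := boolP (x \in B).
  by rewrite (big_fsetD1 x)//= eqxx mul1r big_seq big1 ?addr0// => z;
     rewrite !inE => /andP[/negbTE -> _]; rewrite mul0r.
rewrite big_seq big1 => [|z zB].
  by apply/eqP; apply: contraNT xB => /suppB[].
by case: eqVneq zB xB => [->->//|]; rewrite mul0r.
Qed.

End Support.

(** * Finite energy of the flow in dimension at least three *)

Definition box (N : nat) : {fset 'rV[int]_d} :=
  [fset (\row_k (f k : nat)%:Z) |
     f : {ffun 'I_d -> 'I_N} in predT]%fset.

Lemma mem_box N a : octant a -> (level a < N)%N -> a \in box N.
Proof.
move=> /forallP oa lN.
have aN k : (absz (a 0%R k) < N)%N.
  by apply: leq_ltn_trans lN; rewrite /level (bigD1 k)//= leq_addr.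
apply/imfsetP; exists [ffun k => Ordinal (aN k)] => //=.
by apply/rowP => k; rewrite !mxE ffunE /= gez0_abs.
Qed.

(** The factors decrease in [d], so [d = 3] is the worst case, and there the product telescopes to
    exactly this value. *)
Lemma urn_le (d_ge3 : (3 <= d)%N) n : urn n <= 2 / (n.+1 * n.+2)%:R.
Proof.
elim: n => [|n IH]; first by rewrite /urn big_ord0 mul1n divff.
rewrite urnS; apply: (@le_trans _ _ (2 / (n.+1 * n.+2)%:R * (n.+1%:R / (n + 3)%:R))).
  apply: ler_pM => //; first exact: urn_ge0.
  rewrite ler_pM2l ?ltr0n// lef_pV2 ?posrE ?ltr0n ?ler_nat; [lia|lia|lia].
rewrite !natrM natrD -!natr1 le_eqVlt; apply/orP; left; apply/eqP; field.
have := ler0n R n; lra.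
Qed.

Lemma sum_urn_le (d_ge3 : (3 <= d)%N) N : \sum_(0 <= m < N) urn m <= 2.
Proof.
suff : \sum_(0 <= m < N) urn m <= 2 - 2 / N.+1%:R.
  by move/le_trans; apply; rewrite gerBl divr_ge0.
elim: N => [|N IH]; first by rewrite big_geq// divr1 subrr.
rewrite big_nat_recr//=; apply: le_trans (lerD IH (urn_le d_ge3 N)) _.
rewrite natrM -!natr1 le_eqVlt; apply/orP; left; apply/eqP; field.
have := ler0n R N; lra.
Qed.

Lemma flow_le_urn a k : flow a k <= urn (level a).
Proof.
rewrite /flow; case: ifP => _; last exact: urn_ge0.
rewrite -mulrA ler_piMr ?urn_ge0// ler_pdivrMr ?mul1r ?ltr0n ?ler_nat; last by lia.
by rewrite /level (bigD1 k)//=; lia.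
Qed.

(* The flow is pushed through the potential whose drop across level [n] is
   [urn n], so the representation formula evaluates the energy at once. *)
Lemma flow_energy (d_ge3 : (3 <= d)%N) x B :
  \sum_(z <- B) \sum_k flow (z - x) k ^+ 2 <= 2.
Proof.
pose C := [fset z - x | z in B]%fset.
have -> : \sum_(z <- B) \sum_k flow (z - x) k ^+ 2 =
    \sum_(z <- C) \sum_k flow z k ^+ 2.
  by rewrite /C big_imfset//= => y z _ _ /addIr.
(* [N] exceeds every level met in [C]: the truncated potential [f] has finite support, yet still
   drops by [urn] across each level of [C]. *)
pose N := (\max_(z <- C) level z).+1.
pose f a : R := if octant a then \sum_(level a <= m < N) urn m else 0.
have f_supp z : f z != 0 -> z \in box N.
  rewrite /f; case: ifP => [oz|]; last by rewrite eqxx.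
  have [|Nz] := ltnP (level z) N; first by move=> ? _; exact: mem_box.
  by rewrite big_geq// eqxx.
(* Enlarging [C] to meet the support condition is harmless: every term in the representation of
   [f 0] is nonnegative. *)
pose D := (C `|` (box N `|` \bigcup_(k <- enum 'I_d) [fset z - unit_step k | z in box N]))%fset.
have CD : (C `<=` D)%fset by rewrite fsubsetUl.
have D_supp z : f z != 0 -> z \in D /\ forall k, z - unit_step k \in D.
  move=> /f_supp zN; split => [|k]; rewrite /D !in_fsetU; first by rewrite zN orbT.
  apply/orP; right; apply/orP; right; apply/bigfcupP; exists k; rewrite ?mem_enum//.
  by apply/imfsetP; exists z.
have f_drop a k : octant a -> 0 <= f a - f (a + unit_step k) /\
    ((level a < N)%N -> f a - f (a + unit_step k) = urn (level a)).
  move=> oa; rewrite /f oa octant_step// level_step//.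
  have [aN|aN] := ltnP (level a) N; last by rewrite !big_geq ?subrr//; lia.
  by rewrite big_ltn// addrK; split => //; exact: urn_ge0.
have term_ge0 z k : 0 <= flow (z - 0) k * (f z - f (z + unit_step k)).
  rewrite subr0; have [oz|oz] := boolP (octant z).
    by rewrite mulr_ge0 ?flow_ge0//; have [] := f_drop z k oz.
  by rewrite /flow (negbTE oz) mul0r.
apply: (@le_trans _ _ (f 0)); last first.
  rewrite /f; case: ifP => // _.
  have /eqP -> : level 0 == 0%N by rewrite level_eq0.
  exact: sum_urn_le.
rewrite (flow_representation D_supp 0).
apply: (@le_trans _ _ (\sum_(z <- C) \sum_k flow (z - 0) k * (f z - f (z + unit_step k)))).
  rewrite big_seq [leRHS]big_seq; apply: ler_sum => z zC; apply: ler_sum => k _.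
  rewrite subr0; have [oz|oz] := boolP (octant z); last first.
    by rewrite /flow (negbTE oz) expr0n mul0r.
  have [_ ->//] := f_drop z k oz.
    by rewrite expr2 ler_wpM2l ?flow_ge0// flow_le_urn.
  by rewrite ltnS; apply: leq_bigmax_seq.
rewrite [leRHS](big_fsetID _ (mem C))/=.
have -> : [fset z in D | z \in C]%fset = C.
  by apply/fsetP => z; rewrite !inE/=; case: (boolP (z \in C)) => zC;
     rewrite ?andbF// andbT (fsubsetP CD).
by rewrite lerDl; apply: sumr_ge0 => z _; apply: sumr_ge0.
Qed.

End UrnFlow.

(** * Dirichlet form *)

Section Dirichlet.
Variables (R : realType) (d : nat).
Hypothesis d_ge3 : (3 <= d)%N.
Implicit Types (x y z : 'rV[int]_d) (L : {fset 'rV[int]_d}) (h : 'rV[int]_d -> R).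

Let d_gt0 : (0 < d)%N. Proof. exact: leq_trans d_ge3. Qed.

(** Backward neighbours are included so that functions vanishing off [L] meet the support condition
    of the representation formula. *)
Definition edge_base L : {fset 'rV[int]_d} :=
  (L `|` \bigcup_(k <- enum 'I_d) [fset z - unit_step k | z in L])%fset.

Lemma edge_base_supp L h : (forall z, z \notin L -> h z = 0) ->
  forall z, h z != 0 ->
  z \in edge_base L /\ forall k, z - unit_step k \in edge_base L.
Proof.
move=> hL z hz; have zL : z \in L by apply: contraNT hz => /hL ->.
split => [|k]; rewrite /edge_base in_fsetU ?zL//.
apply/orP; right; apply/bigfcupP; exists k; rewrite ?mem_enum//.
by apply/imfsetP; exists z.
Qed.

Definition gradient_energy L h : R :=
  \sum_(z <- edge_base L) \sum_k (h z - h (z + unit_step k)) ^+ 2.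

Definition field_flow_energy L (eta : 'rV[int]_d -> R) : R :=
  \sum_(z <- edge_base L) \sum_k
    (\sum_(x <- L) eta x * flow R (z - x) k) ^+ 2.

(** The representation formula turns the field term into a pairing of a superposed flow with the
    gradient; Young's inequality with weight [kappa] then applies edge by edge. *)
Lemma field_coupling_le L h eta kappa : 0 < kappa ->
  (forall z, z \notin L -> h z = 0) ->
  \sum_(x <- L) eta x * h x <=
  (2 * kappa)^-1 * field_flow_energy L eta + kappa / 2 * gradient_energy L h.
Proof.
move=> k0 hL.
have -> : \sum_(x <- L) eta x * h x = \sum_(z <- edge_base L) \sum_k
    (\sum_(x <- L) eta x * flow R (z - x) k) * (h z - h (z + unit_step k)).
  under eq_bigr => x _.
    rewrite (flow_representation d_gt0 (edge_base_supp hL) x) mulr_sumr.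
    under eq_bigr do rewrite mulr_sumr.
    over.
  rewrite exchange_big/=; apply: eq_bigr => z _.
  rewrite exchange_big/=; apply: eq_bigr => k _.
  by rewrite mulr_suml; apply: eq_bigr => x _; rewrite mulrA.
rewrite !mulr_sumr -big_split/=; apply: ler_sum => z _.
rewrite !mulr_sumr -big_split/=; apply: ler_sum => k _.
set u := \sum_(_ <- L) _; set v := h z - _.
rewrite -subr_ge0 (_ : _ - _ = (2 * kappa)^-1 * (u - kappa * v) ^+ 2).
  by rewrite mulr_ge0 ?sqr_ge0// invr_ge0; lra.
by field; lra.
Qed.

Lemma sqr_le_gradient_energy L h x : (forall z, z \notin L -> h z = 0) ->
  h x ^+ 2 <= 2 * gradient_energy L h.
Proof.
move=> hL; have [xL|/hL ->] := boolP (x \in L); last first.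
  rewrite expr0n mulr_ge0//; apply: sumr_ge0 => z _.
  by apply: sumr_ge0 => k _; exact: sqr_ge0.
(* A field [h x / 2] at the single site [x] with [kappa = 1] gives
   [h x ^ 2 / 2 <= h x ^ 2 / 4 + D / 2], where [D] is the gradient energy. *)
have := @field_coupling_le L h (fun y => if y == x then h x / 2 else 0) 1 ltr01 hL.
rewrite (big_fsetD1 x)//= eqxx big_seq big1 ?addr0; last first.
  by move=> z; rewrite !inE => /andP[/negbTE -> _]; rewrite mul0r.
have : field_flow_energy L (fun y => if y == x then h x / 2 else 0) <= h x ^+ 2 / 2.
  rewrite /field_flow_energy.
  rewrite (_ : \sum_(_ <- _) _ = (h x / 2) ^+ 2 *
      \sum_(z <- edge_base L) \sum_k flow R (z - x) k ^+ 2).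
    have := ler_wpM2l (sqr_ge0 (h x / 2)) (flow_energy R d_gt0 d_ge3 x (edge_base L)).
    move/le_trans; apply; rewrite expr_div_n; lra.
  rewrite mulr_sumr; apply: eq_bigr => z _; rewrite mulr_sumr; apply: eq_bigr => k _.
  rewrite (big_fsetD1 x)//= eqxx big_seq big1 ?addr0 ?exprMn//.
  by move=> y; rewrite !inE => /andP[/negbTE -> _]; rewrite mul0r.
rewrite mulr1 mul1r expr2; lra.
Qed.

(** An inner bond is visited from both ends and counts one half each time; a boundary bond is
    visited once, from its end in [L]. *)
Definition bond_weight L y : R := if y \in L then 2^-1 else 1.

Definition bond_sum L (W : R -> R) h : R :=
  \sum_(x <- L) \sum_(y <- neighbours x) bond_weight L y * W (h x - h y).

Lemma bond_weight_ge L y : 2^-1 <= bond_weight L y.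
Proof. by rewrite /bond_weight; case: ifP => // _; lra. Qed.

Lemma bond_weight_ge0 L y : 0 <= bond_weight L y.
Proof. by have := bond_weight_ge L y; lra. Qed.

Lemma bond_sumD L W1 W2 h : bond_sum L W1 h + bond_sum L W2 h =
  bond_sum L (fun t => W1 t + W2 t) h.
Proof.
rewrite /bond_sum -big_split/=; apply: eq_bigr => x _.
by rewrite -big_split/=; apply: eq_bigr => y _; rewrite mulrDr.
Qed.

Lemma bond_sumZ L (k : R) W h : k * bond_sum L W h = bond_sum L (fun t => k * W t) h.
Proof.
rewrite /bond_sum mulr_sumr; apply: eq_bigr => x _.
by rewrite mulr_sumr; apply: eq_bigr => y _; rewrite mulrCA.
Qed.

Lemma size_neighbours x : size (neighbours x) = d.*2.
Proof. by rewrite /neighbours size_cat !size_map -enumT size_enum_ord addnn. Qed.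

Lemma bond_sum_cst_le L (a : R) h : 0 <= a ->
  bond_sum L (fun=> a) h <= (d.*2 * #|` L|)%:R * a.
Proof.
move=> a0; rewrite /bond_sum.
apply: (@le_trans _ _ (\sum_(x <- L) d.*2%:R * a)); last first.
  by rewrite big_const_seq count_predT iter_addr addr0 -[leLHS]mulr_natl natrM mulrCA mulrA.
apply: ler_sum => x _; rewrite -(size_neighbours x).
apply: (@le_trans _ _ (\sum_(y <- neighbours x) a)).
  apply: ler_sum => y _; apply: ler_piMl => //.
  by rewrite /bond_weight; case: ifP => // _; lra.
by rewrite big_const_seq count_predT iter_addr addr0 mulr_natl.
Qed.

(** An edge with nonzero gradient has an endpoint in [L], from which the bond sum sees it with
    weight at least one half. *)
Lemma gradient_energy_le L h : (forall z, z \notin L -> h z = 0) ->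
  gradient_energy L h <= 2 * bond_sum L (fun t => t ^+ 2) h.
Proof.
move=> hL.
pose g z k := (h z - h (z + unit_step k)) ^+ 2.
have g0 z k : 0 <= g z k by exact: sqr_ge0.
have sub_le (A B : {fset 'rV[int]_d}) (f : 'rV[int]_d -> R) :
    (A `<=` B)%fset -> (forall z, 0 <= f z) ->
    \sum_(z <- A) f z <= \sum_(z <- B) f z.
  move=> AB f0; rewrite [leRHS](big_fsetID _ (mem A))/=.
  have -> : [fset z in B | z \in A]%fset = A.
    by apply/fsetP => z; rewrite !inE/=; case: (boolP (z \in A)) => zA;
       rewrite ?andbF// andbT (fsubsetP AB).
  by rewrite lerDl; apply: sumr_ge0.
apply: (@le_trans _ _ (\sum_(x <- L) \sum_k g x k +
    \sum_(x <- L) \sum_k g (x - unit_step k) k)).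
  rewrite [X in _ <= _ + X]exchange_big/= [X in _ <= X + _]exchange_big/=.
  rewrite -big_split /gradient_energy exchange_big/=; apply: ler_sum => k _.
  have -> : \sum_(x <- L) g (x - unit_step k) k =
      \sum_(z <- [fset x - unit_step k | x in L]%fset) g z k.
    by rewrite big_imfset//= => x y _ _ /addIr.
  set T := [fset _ | _ in _]%fset.
  have LE : (L `<=` edge_base L)%fset by rewrite fsubsetUl.
  rewrite (big_fsetID _ (mem L))/=; apply: lerD.
    apply: sub_le => [|z]; last exact: g0.
    by apply/fsubsetP => z; rewrite !inE => /andP[].
  rewrite (big_fsetID _ (mem T))/= [X in _ + X]big_seq.
  rewrite [X in _ + X]big1 ?addr0 => [|z].
    apply: sub_le => [|z]; last exact: g0.
    by apply/fsubsetP => z; rewrite !inE => /andP[].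
  rewrite !inE => /andP[/andP[_ zL] zT].
  rewrite hL// [X in _ - X]hL ?subrr ?expr0n//.
  by apply: contra zT => ?; apply/imfsetP; exists (z + unit_step k); rewrite ?addrK.
rewrite -big_split/= /bond_sum mulr_sumr; apply: ler_sum => x _.
apply: (@le_trans _ _ (\sum_(y <- neighbours x) (h x - h y) ^+ 2)).
  rewrite /neighbours big_cat/= !big_map -!enumT.
  rewrite le_eqVlt; apply/orP; left; apply/eqP; congr (_ + _).
    by rewrite big_enum.
  rewrite big_enum; apply: eq_bigr => k _.
  by rewrite /g subrK -opprB sqrrN.
rewrite mulr_sumr; apply: ler_sum => y _.
have := ler_wpM2r (sqr_ge0 (h x - h y)) (bond_weight_ge L y); lra.
Qed.

End Dirichlet.

(** * Strongly convex potentials *)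

Section Potential.
Variables (R : realType) (V : R -> R) (c : R).
Hypothesis c_gt0 : 0 < c.
Hypothesis dV : forall t : R, derivable V t 1.
Hypothesis d2V : forall t : R, derivable (derive1 V) t 1.
Hypothesis infV : inf (range (derive1n 2 V)) = c.

(** [inf] defaults to 0 on a set with no lower bound; as [c > 0], the range is bounded below and [c]
    is a true infimum. *)
Lemma derive2_ge t : c <= derive1n 2 V t.
Proof.
rewrite -infV; apply: ge_inf; last by exists t.
apply: contrapT => nlb; have : inf (range (derive1n 2 V)) = 0.
  by apply: inf_out => -[_ /nlb].
by rewrite infV => c0; move: c_gt0; rewrite c0 ltxx.
Qed.

Lemma potential_continuous : continuous V.
Proof. by move=> t; apply: differentiable_continuous; apply/derivable1_diffP. Qed.

Lemma mvt (f f' : R -> R) (a b : R) :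
  (forall t : R, is_derive t 1 f (f' t)) ->
  exists2 u, (a <= u <= b) || (b <= u <= a) & f b - f a = f' u * (b - a).
Proof.
move=> df.
have cf (x y : R) : {within `[x, y], continuous f}.
  apply: continuous_subspaceT => t; apply: differentiable_continuous.
  by apply/derivable1_diffP; have [] := df t.
have [ab|ba|->] := ltgtP a b.
- have [u + e] := @MVT R f f' a b ab (fun t _ => df t) (cf a b).
  by rewrite in_itv/= => /andP[au ub]; exists u => //; apply/orP; left; rewrite !ltW.
- have [u + e] := @MVT R f f' b a ba (fun t _ => df t) (cf b a).
  rewrite in_itv/= => /andP[au ub]; exists u; first by apply/orP; right; rewrite !ltW.
  by apply: oppr_inj; rewrite opprB e -mulrN opprB.
- by exists b; rewrite ?lexx// !subrr mulr0.
Qed.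

Lemma derive_slope_ge (s t : R) :
  c * (t - s) ^+ 2 <= (derive1 V t - derive1 V s) * (t - s).
Proof.
have [|u _ ->] := @mvt (derive1 V) (derive1n 2 V) s t.
  move=> r; rewrite /derive1n/= derive1E; exact/derivableP.
rewrite expr2 mulrA -!mulrA ler_wpM2r ?derive2_ge// -expr2 sqr_ge0//.
Qed.

(** Subtracting the parabola leaves a function whose derivative at [u] has, weakly, the sign of
    [u - s] by the slope bound; the mean value theorem concludes. *)
Lemma tangent_parabola_le (s t : R) :
  V s + derive1 V s * (t - s) + c / 2 * (t - s) ^+ 2 <= V t.
Proof.
pose g r := V r - derive1 V s * (r - s) - c / 2 * (r - s) ^+ 2.
have [|u su] := @mvt g (fun r => derive1 V r - derive1 V s - c * (r - s)) s t.
  move=> r; rewrite /g; have dVr : is_derive r 1 V (derive1 V r).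
    by rewrite derive1E; exact/derivableP.
  apply: is_derive_eq; rewrite /GRing.scale/= !subr0; by field.
rewrite /g !subrr expr0n/= !mulr0 !subr0 => e.
suff : 0 <= (derive1 V u - derive1 V s - c * (u - s)) * (t - s) by lra.
have := derive_slope_ge s u.
case/orP: su => /andP[]; rewrite le_eqVlt => /predU1P[->|su]; rewrite ?subrr ?mulr0 ?subr0 ?mul0r//.
- move=> ut h; apply: mulr_ge0; last by lra.
  have us : 0 < u - s by lra.
  by rewrite -(pmulr_lge0 _ us) mulrBl -mulrA -expr2; lra.
- by rewrite le_eqVlt => /predU1P[->|]; rewrite ?subrr ?mulr0 ?subr0 ?mul0r//; lra.
- rewrite le_eqVlt => /predU1P[->|us] h; rewrite ?subrr ?mulr0 ?subr0 ?mul0r//.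
  apply: mulr_le0; last by lra.
  have su0 : u - s < 0 by lra.
  by rewrite -(nmulr_lge0 _ su0) mulrBl -mulrA -expr2; lra.
Qed.

(** The tangent parabola at the midpoint is evaluated at [s] and [t]: the linear terms cancel and
    each quadratic term is [c / 8 * (s - t) ^ 2]. *)
Lemma potential_midpoint (s t : R) :
  V (2^-1 * (s + t)) <= 2^-1 * (V s + V t) - c / 8 * (s - t) ^+ 2.
Proof.
set m := 2^-1 * (s + t).
have h1 := tangent_parabola_le m s; have h2 := tangent_parabola_le m t.
have e1 : s - m = 2^-1 * (s - t) by rewrite /m; field.
have e2 : t - m = - (2^-1 * (s - t)) by rewrite /m; field.
move: h1 h2; rewrite e1 e2 sqrrN exprMn mulrN.
set q := (s - t) ^+ 2; set p := derive1 V m * _.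
lra.
Qed.

(** Half of the quadratic term completes the square with the linear one, so a slope at the origin
    costs only a constant. *)
Lemma potential_ge (t : R) :
  V 0 - derive1 V 0 ^+ 2 / c + c / 4 * t ^+ 2 <= V t.
Proof.
have := tangent_parabola_le 0 t; rewrite subr0; apply: le_trans.
rewrite -subr_ge0 (_ : _ - _ = c^-1 * (derive1 V 0 + c / 2 * t) ^+ 2).
  by rewrite mulr_ge0 ?sqr_ge0// invr_ge0; exact: ltW.
by field; rewrite gt_eqF.
Qed.

End Potential.

(** * Integrating out strongly convex energies *)

Section SiteProduct.
Variables (R : realType) (eps : {nonneg R}).
Local Notation RM := (measurableTypeR R).

(* A constant of its own, to carry the sigma-finite instance. *)
Definition site_product (n : nat) : set (n.-tuple RM) -> \bar R :=
  product_site_measure eps n.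
Arguments site_product : clear implicits.

HB.instance Definition _ n := Measure.on (site_product n).

Lemma site_measureE (A : set RM) :
  site_measure eps A = (lebesgue_measure A + eps%:num%:E * \d_(0%R : RM) A)%E.
Proof. exact: measure_addE. Qed.

Lemma site_product_sigma_finite n : sigma_finite setT (site_product n).
Proof.
pose J (k : nat) : set RM := `[- k%:R, k%:R]%classic.
have mJ k : measurable (J k) by exact: measurable_itv.
pose F k := [set t : n.-tuple RM | forall i, J k (tnth t i)].
exists F.
  apply/esym/seteqP; split => // t _.
  exists (\max_(i < n) Num.bound `|(tnth t i : R)|%R)%N => // i /=.
  rewrite /J/= in_itv/= -ler_norml.
  apply: le_trans (ltW (archi_boundP (normr_ge0 _))) _.
  by rewrite ler_nat (leq_bigmax i).
move=> k; split.
  have -> : F k = \bigcap_(i in [set: 'I_n]) ((fun t => tnth t i) @^-1` J k).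
    by apply/seteqP; split => [t Bt i _|t Bt i]; [exact: Bt|exact: (Bt i I)].
  apply: fin_bigcap_measurable => // i _.
  rewrite -[X in measurable X]setTI.
  by apply: (@measurable_tnth _ RM n i) .
rewrite /site_product (@product_site_measureE R eps n (fun=> J k))//.
have : (\prod_(i < n) site_measure eps (J k))%E \is a fin_num.
  apply: prode_fin_num => i _.
  rewrite site_measureE fin_numD lebesgue_measure_itv/= diracE -EFinM.
  by rewrite andbT; case: ifP.
by rewrite ge0_fin_numE//; exact: prode_ge0.
Qed.

HB.instance Definition _ n :=
  Measure_isSigmaFinite.Build _ _ _ (site_product n) (site_product_sigma_finite n).

Lemma integral_site_measure (f : RM -> \bar R) :
  measurable_fun setT f -> (forall x, 0 <= f x)%E ->
  (\int[site_measure eps]_x f x =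
   \int[lebesgue_measure]_x f x + eps%:num%:E * f 0%R)%E.
Proof.
move=> mf f0; rewrite ge0_integral_measure_add//.
by rewrite ge0_integral_mscale// integral_dirac// diracT mul1e.
Qed.

Lemma integral_site_productS n (f : n.+1.-tuple RM -> \bar R) :
  measurable_fun setT f -> (forall t, 0 <= f t)%E ->
  (\int[site_product n.+1]_t f t =
   \int[site_measure eps]_x \int[site_product n]_t f [tuple of x :: t])%E.
Proof.
move=> mf f0.
transitivity (\int[(site_product n \x site_measure eps)%E]_z (f \o @tuple_push R n) z)%E.
  rewrite -[RHS](@ge0_integral_pushforward _ _ _ _ _ _ (@measurable_tuple_push R n) _ setT)//.
rewrite fubini_tonelli2//; last by move=> z; exact: f0.
by apply: measurableT_comp => //; exact: measurable_tuple_push.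
Qed.

Definition midpoint n (s t : n.-tuple RM) : n.-tuple RM :=
  [tuple 2^-1 * (tnth s i + tnth t i) | i < n].

(** For [eps > 0] the factor [1 / eps] turns the atom [eps * delta_0] into [delta_0]: a discounted
    integral at strength [eps] is an integral at strength one. *)
Definition pin_discount (x : RM) : R := if x == 0 then eps%:num^-1 else 1.

Definition discount n (t : n.-tuple RM) : R := \prod_(i < n) pin_discount (tnth t i).

Lemma pin_discount_ge0 x : 0 <= pin_discount x.
Proof. by rewrite /pin_discount; case: ifP; rewrite ?invr_ge0. Qed.

Lemma discount_ge0 n (t : n.-tuple RM) : 0 <= discount t.
Proof. by apply: prodr_ge0 => i _; exact: pin_discount_ge0. Qed.

Lemma measurable_pin_discount : measurable_fun setT pin_discount.
Proof.
rewrite (_ : pin_discount =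
  (fun x => (eps%:num^-1 - 1) * \1_[set 0%R] x + 1)).
  by apply: measurable_funD => //; exact: measurable_funM.
apply/funext => x; rewrite /pin_discount indicE; have [->|x0] := eqVneq x 0.
  by rewrite mem_set// mulr1 subrK.
by rewrite memNset ?mulr0 ?add0r//; exact/eqP.
Qed.

Lemma measurable_discount n : measurable_fun setT (@discount n).
Proof.
apply: measurable_prod => i _; apply: measurableT_comp => //.
  exact: measurable_pin_discount.
exact: measurable_tnth.
Qed.

(** For [C > 0] this is [sqrt (4 * pi * C)], the inverse peak of the normal density of variance
    [2 * C]. *)
Definition gauss_mass (C : R) : R := (normal_peak (Num.sqrt (2 * C)))^-1.

Lemma gauss_mass_ge0 C : 0 <= gauss_mass C.
Proof. by rewrite invr_ge0 normal_peak_ge0. Qed.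

Lemma integral_gauss_shift (C a : R) : 0 < C ->
  (\int[lebesgue_measure]_x (expR (- ((x - a) ^+ 2 / (4 * C))))%:E =
   (gauss_mass C)%:E)%E.
Proof.
move=> C0; set s := Num.sqrt (2 * C).
have s0 : s != 0 by rewrite gt_eqF// sqrtr_gt0 mulr_gt0.
have p0 := normal_peak_gt0 s0.
rewrite -[RHS]mule1 -(integral_normal_pdf a s) -ge0_integralZl//.
- apply: eq_integral => x _; rewrite (normal_pdfE _ s0) -EFinM mulrA mulVf ?mul1r ?gt_eqF//.
  rewrite /normal_fun sqr_sqrtr ?mulr_ge0 ?ltW//.
  congr (expR _)%:E; rewrite mulNr -mulr_natr; congr (- (_ / _)); ring.
- by apply/measurable_EFinP; exact: measurable_normal_pdf.
- by move=> x _; rewrite lee_fin normal_pdf_ge0.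
- by rewrite lee_fin gauss_mass_ge0.
Qed.

(** The exponential pays for one unit of energy, [gauss_mass C] for the Lebesgue part and 1 for the
    discounted atom. *)
Definition site_factor (C : R) : R := expR 1 * (gauss_mass C + 1).

(* An approximate minimiser [x0 :: t0] of [E] serves every slice: the midpoint
   inequality gives [E (x :: t) >= m - 1 + (x - x0)^2 / 4C] for all [t], so the
   first coordinate costs one Gaussian integral and one unit of [m]. *)
Lemma strongly_convex_integral (C : R) n (E : n.-tuple RM -> R) (m : R) :
  0 < C -> 1 <= eps%:num -> measurable_fun setT E ->
  (forall s t i, E (midpoint s t) <=
     2^-1 * (E s + E t) - (tnth s i - tnth t i) ^+ 2 / (8 * C)) ->
  (forall s, m <= E s) ->
  (\int[site_product n]_t (expR (- E t) * discount t)%:E <=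
   (site_factor C ^+ n * expR (- m))%:E)%E.
Proof.
move=> C0 e1; elim: n E m => [|n IH] E m mE midE lbE.
  rewrite /site_product/= integral_dirac//; last first.
    apply/measurable_EFinP; apply: measurable_funM; last exact: measurable_discount.
    by apply: measurableT_comp => //; exact: measurableT_comp.
  by rewrite diracT mul1e lee_fin /discount big_ord0 mulr1 expr0 mul1r ler_expR lerN2.
pose S := range E.
have hS : has_inf S by split; [exists (E [tuple 0 | i < n.+1]), [tuple 0 | i < n.+1]|
  exists m => _ [s _ <-]].
have [_ [s0 _ <-] s0_lt] := inf_adherent ltr01 hS.
have mS : m <= inf S by apply: lb_le_inf; [case: hS|move=> _ [s _ <-]].
have infE s : inf S <= E s by apply: ge_inf; [case: hS|exists s].
set x0 := tnth s0 ord0 in s0_lt *.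
(* The midpoint of [x :: t] and [s0] has energy at least [inf S], while [E s0 < inf S + 1]; solving
   for [E (x :: t)] doubles the quadratic gain. *)
have slice (x : RM) (t : n.-tuple RM) : m - 1 + (x - x0) ^+ 2 / (4 * C) <= E [tuple of x :: t].
  have := le_trans (infE _) (midE [tuple of x :: t] s0 ord0).
  rewrite tnth0 -/x0 (_ : _ / (8 * C) = 2^-1 * ((x - x0) ^+ 2 / (4 * C))).
    by set q := _ / _; lra.
  by field; rewrite gt_eqF.
have mcons (x : RM) : measurable_fun setT (fun t : n.-tuple RM => [tuple of x :: t]).
  exact: measurable_cons.
have pin_le1 x : pin_discount x <= 1.
  by rewrite /pin_discount; case: ifP => // _; rewrite invf_le1//; exact: lt_le_trans e1.
have mw : measurable_fun setT (fun t : n.+1.-tuple RM => (expR (- E t) * discount t)%:E).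
  apply/measurable_EFinP; apply: measurable_funM; last exact: measurable_discount.
  by apply: measurableT_comp => //; exact: measurableT_comp.
have w0 k (E' : k.-tuple RM -> R) t : (0 <= (expR (- E' t) * discount t)%:E)%E.
  by rewrite lee_fin mulr_ge0 ?expR_ge0 ?discount_ge0.
rewrite integral_site_productS//.
set g := fun x : RM => site_factor C ^+ n * expR (1 - m) * expR (- ((x - x0) ^+ 2 / (4 * C))).
have K0 : 0 <= site_factor C by rewrite mulr_ge0 ?expR_ge0// addr_ge0 ?gauss_mass_ge0.
have g0 x : 0 <= g x by rewrite !mulr_ge0 ?expR_ge0// exprn_ge0.
have mg : measurable_fun setT g.
  apply: measurable_funM => //; apply: measurableT_comp => //.
  apply: measurableT_comp => //; apply: measurable_funM => //.
  by apply: measurable_funX => //; exact: measurable_funB.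
have inner (x : RM) : (\int[site_product n]_t
    (expR (- E [tuple of x :: t]) * discount [tuple of x :: t])%:E <=
    (pin_discount x * g x)%:E)%E.
  rewrite EFinM.
  have -> : (\int[site_product n]_t
      (expR (- E [tuple of x :: t]) * discount [tuple of x :: t])%:E =
      (pin_discount x)%:E * \int[site_product n]_t
      (expR (- E [tuple of x :: t]) * discount t)%:E)%E.
    rewrite -ge0_integralZl//.
    - apply: eq_integral => t _; rewrite -EFinM; congr (_%:E).
      rewrite {1}/discount big_ord_recl tnth0 mulrCA; congr (_ * (_ * _)).
      by apply: eq_bigr => i _; rewrite tnthS.
    - apply/measurable_EFinP; apply: measurable_funM; last exact: measurable_discount.
      by apply: measurableT_comp => //; do 2 apply: measurableT_comp => //.
    - by move=> t _; exact: (w0 _ (fun t => E [tuple of x :: t])).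
    - by rewrite lee_fin pin_discount_ge0.
  apply: lee_wpmul2l; first by rewrite lee_fin pin_discount_ge0.
  apply: le_trans (IH (fun t => E [tuple of x :: t]) _ _ _ (slice x)) _.
  - exact: measurableT_comp.
  (* A slice inherits the midpoint inequality, since tuples with common head [x] have a midpoint
     with head [x]. *)
  - move=> s t i; have := midE [tuple of x :: s] [tuple of x :: t] (lift ord0 i).
    rewrite !tnthS; congr (E _ <= _); apply: eq_from_tnth => j.
    rewrite tnth_mktuple; case: (unliftP ord0 j) => [k ->|->].
      by rewrite !tnthS tnth_mktuple.
    by rewrite !tnth0; field.
  - rewrite lee_fin /g -mulrA ler_wpM2l ?exprn_ge0// -expRD ler_expR; lra.
apply: (@le_trans _ _ (\int[site_measure eps]_x (pin_discount x * g x)%:E)%E).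
  apply: ge0_le_integral => //.
  - by move=> x _; apply: integral_ge0.
  - have := @measurable_fun_fubini_tonelli_G _ _ _ _ _ (site_product n)
      (fun z => (expR (- E (tuple_push z)) * discount (tuple_push z))%:E).
    apply => //.
    by apply: (measurableT_comp mw); exact: measurable_tuple_push.
  - by apply/measurable_EFinP; apply: measurable_funM => //; exact: measurable_pin_discount.
rewrite integral_site_measure; first last.
- by move=> x; rewrite lee_fin mulr_ge0// pin_discount_ge0.
- by apply/measurable_EFinP; apply: measurable_funM => //; exact: measurable_pin_discount.
have -> : site_factor C ^+ n.+1 * expR (- m) =
    site_factor C ^+ n * expR (1 - m) * gauss_mass C + site_factor C ^+ n * expR (1 - m).
  by rewrite exprSr /site_factor expRD; ring.
rewrite EFinD; apply: leeD.
  apply: (@le_trans _ _ (\int[lebesgue_measure]_x (g x)%:E)%E).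
    apply: ge0_le_integral => //.
    - by move=> x _; rewrite lee_fin mulr_ge0// pin_discount_ge0.
    - by apply/measurable_EFinP; apply: measurable_funM => //; exact: measurable_pin_discount.
    - exact/measurable_EFinP.
    - by move=> x _; rewrite lee_fin ler_piMl.
  rewrite [leRHS]EFinM -(integral_gauss_shift x0 C0) -ge0_integralZl//.
  - apply/measurable_EFinP; apply: measurableT_comp => //.
    apply: measurableT_comp => //; apply: measurable_funM => //.
    by apply: measurable_funX => //; exact: measurable_funB.
  - by rewrite lee_fin mulr_ge0 ?expR_ge0// exprn_ge0.
(* At the atom the discount cancels [eps], leaving [g 0], whose Gaussian factor is at most 1. *)
rewrite -EFinM lee_fin /pin_discount eqxx mulrA mulfV ?mul1r; last first.
  by rewrite gt_eqF//; exact: lt_le_trans e1.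
rewrite /g ler_piMr//; first by rewrite mulr_ge0 ?expR_ge0// exprn_ge0.
by rewrite -[leRHS]expR0 ler_expR oppr_le0 divr_ge0 ?sqr_ge0// mulr_ge0// ltW.
Qed.
End SiteProduct.

(** * Energy bounds *)

Section GibbsBound.
Variables (R : realType) (d : nat) (L : {fset 'rV[int]_d}).
Local Notation n := (#|` L|).
Local Notation RM := (measurableTypeR R).
Implicit Types (phi s t : n.-tuple RM) (x : 'rV[int]_d) (eta : 'rV[int]_d -> R).

Definition ht phi x : R := @height R d L phi x.

Lemma height_off phi x : x \notin L -> ht phi x = 0.
Proof. by move=> xL; rewrite /ht /height memNindex// nth_default// size_tuple. Qed.

Lemma height_site phi (i : 'I_n) : ht phi (nth 0 (enum_fset L) i) = tnth phi i.
Proof. by rewrite /ht /height index_uniq ?fset_uniq// (tnth_nth 0). Qed.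

Lemma sum_sites (F : 'rV[int]_d -> R) :
  \sum_(x <- L) F x = \sum_(i < n) F (nth 0 (enum_fset L) i).
Proof. by rewrite (big_nth 0) big_mkord. Qed.

Lemma site_index x : x \in L -> exists i : 'I_n, x = nth 0 (enum_fset L) i.
Proof.
move=> xL; have ix : (index x (enum_fset L) < n)%N by rewrite index_mem.
by exists (Ordinal ix); rewrite /= nth_index.
Qed.

Lemma height_midpoint s t x : ht (midpoint s t) x = 2^-1 * (ht s x + ht t x).
Proof.
have [/site_index[i ->]|xL] := boolP (x \in L); last first.
  by rewrite !height_off// addr0 mulr0.
by rewrite !height_site tnth_mktuple.
Qed.

Lemma measurable_height x : measurable_fun setT (ht ^~ x).
Proof.
have [/site_index[i ->]|xL] := boolP (x \in L); last first.
  rewrite (_ : ht ^~ x = cst 0)//.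
  by apply/funext => phi; rewrite height_off.
rewrite (_ : ht ^~ _ = (fun t => tnth t i)); first exact: measurable_tnth.
by apply/funext => phi; rewrite height_site.
Qed.

Variables (V : R -> R).

Definition energy eta (h : 'rV[int]_d -> R) : R :=
  (4 * d%:R)^-1 * bond_sum L V h - \sum_(x <- L) eta x * h x.

(** Boundary bonds see height 0 outside [L], so bulk and boundary energies merge into one bond
    sum. *)
Lemma gibbs_weightE eta phi : gibbs_weight V eta phi = expR (- energy eta (ht phi)).
Proof.
have h : bulk_energy V phi + boundary_energy V phi = bond_sum L V (ht phi).
  rewrite /bulk_energy /boundary_energy mulr_sumr -big_split/=.
  apply: eq_bigr => x _; rewrite [RHS](bigID (fun y => y \in L))/= mulr_sumr.
  congr (_ + _); apply: eq_bigr => y yL; rewrite /bond_weight ?yL// (negbTE yL).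
  by rewrite mul1r [ht phi y]height_off// subr0.
rewrite /gibbs_weight /energy -h; congr expR.
by rewrite mulNr opprB mulrDr opprD [RHS]addrC.
Qed.

Variable c : R.
Hypothesis d_ge3 : (3 <= d)%N.
Hypothesis c_gt0 : 0 < c.
Hypothesis dV : forall t : R, derivable V t 1.
Hypothesis d2V : forall t : R, derivable (derive1 V) t 1.
Hypothesis infV : inf (range (derive1n 2 V)) = c.

Let d_gt0 : 0 < d%:R :> R. Proof. by rewrite ltr0n; exact: leq_trans d_ge3. Qed.

(** Makes [1 / (8 * convexity_const)] the product of the prefactor [1 / (4 d)], the midpoint gain
    [c / 8] and the factor [1 / 4] from transience. *)
Definition convexity_const : R := 16 * d%:R / c.

Lemma convexity_const_gt0 : 0 < convexity_const.
Proof. by rewrite divr_gt0// mulr_gt0. Qed.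

Lemma bond_sum_le (W1 W2 : R -> R) (h : 'rV[int]_d -> R) :
  (forall r, W1 r <= W2 r) -> bond_sum L W1 h <= bond_sum L W2 h.
Proof.
move=> W12; apply: ler_sum => x _; apply: ler_sum => y _.
by rewrite ler_wpM2l// bond_weight_ge0.
Qed.

(** The field term is linear and cancels; each bond gains by strong convexity, and transience
    converts the total gain into one for any single coordinate. *)
Lemma energy_midpoint eta s t (i : 'I_n) :
  energy eta (ht (midpoint s t)) <=
  2^-1 * (energy eta (ht s) + energy eta (ht t)) -
    (tnth s i - tnth t i) ^+ 2 / (8 * convexity_const).
Proof.
pose h x := ht s x - ht t x.
have h_off x : x \notin L -> h x = 0 by move=> xL; rewrite /h !height_off ?subrr.
have hi : (tnth s i - tnth t i) ^+ 2 <= 4 * bond_sum L (fun r => r ^+ 2) h.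
  rewrite -!height_site; apply: le_trans (sqr_le_gradient_energy d_ge3 _ h_off) _.
  have := gradient_energy_le h_off; lra.
have hb : bond_sum L V (ht (midpoint s t)) <= 2^-1 * (bond_sum L V (ht s) +
    bond_sum L V (ht t)) - c / 8 * bond_sum L (fun r => r ^+ 2) h.
  rewrite /bond_sum -big_split/= !mulr_sumr -sumrB; apply: ler_sum => x _.
  rewrite -big_split/= !mulr_sumr -sumrB; apply: ler_sum => y _.
  have -> : ht (midpoint s t) x - ht (midpoint s t) y =
      2^-1 * ((ht s x - ht s y) + (ht t x - ht t y)).
    by rewrite !height_midpoint; ring.
  have -> : h x - h y = (ht s x - ht s y) - (ht t x - ht t y) by rewrite /h; ring.
  have := ler_wpM2l (bond_weight_ge0 R L y) (potential_midpoint c_gt0 dV d2V infV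
    (ht s x - ht s y) (ht t x - ht t y)); lra.
have hf : \sum_(x <- L) eta x * ht (midpoint s t) x =
    2^-1 * (\sum_(x <- L) eta x * ht s x + \sum_(x <- L) eta x * ht t x).
  rewrite -big_split/= mulr_sumr; apply: eq_bigr => x _.
  by rewrite height_midpoint; ring.
rewrite /energy hf.
have k0 : 0 <= (4 * d%:R)^-1 :> R by rewrite invr_ge0 mulr_ge0// ltW.
have := ler_wpM2l k0 hb.
have -> : (tnth s i - tnth t i) ^+ 2 / (8 * convexity_const) =
    (4 * d%:R)^-1 * (c / 32 * (tnth s i - tnth t i) ^+ 2).
  rewrite /convexity_const; field.
  by rewrite !gt_eqF.
have := ler_wpM2l k0 (ler_wpM2l (_ : 0 <= c / 32) hi).
have -> : 0 <= c / 32 by rewrite divr_ge0// ltW.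
move=> /(_ isT); rewrite !mulrBr !mulrDr; lra.
Qed.

Definition field_cost eta : R := 8 * d%:R / c * field_flow_energy L eta.

(** The middle term is the slope cost [derive1 V 0 ^ 2 / c] for [2 d] bonds per site, times the
    prefactor [1 / (4 d)]. *)
Definition energy_floor eta : R :=
  energy eta (fun=> 0) - n%:R * (derive1 V 0 ^+ 2 / (2 * c)) - field_cost eta.

Lemma energy_ge eta phi : energy_floor eta <= energy eta (ht phi).
Proof.
have off x : x \notin L -> ht phi x = 0 by exact: height_off.
pose v := derive1 V 0 ^+ 2 / c.
have v0 : 0 <= v by rewrite divr_ge0 ?sqr_ge0// ltW.
have hV : bond_sum L V (fun=> 0) - (d.*2 * n)%:R * v +
    c / 4 * bond_sum L (fun r => r ^+ 2) (ht phi) <= bond_sum L V (ht phi).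
  apply: le_trans (bond_sum_le (ht phi) (potential_ge c_gt0 dV d2V infV)).
  rewrite -(bond_sumD L (fun=> V 0 - v) (fun r => c / 4 * r ^+ 2)) bond_sumZ lerD2r.
  have := bond_sum_cst_le L (ht phi) v0.
  have -> : bond_sum L V (fun=> 0) = bond_sum L (fun=> V 0 - v) (ht phi) +
      bond_sum L (fun=> v) (ht phi).
    rewrite bond_sumD; apply: eq_bigr => x _; apply: eq_bigr => y _.
    by rewrite subrr subrK.
  lra.
(* With this value as [kappa], the quadratic part of the bond sum absorbs exactly the gradient term
   of the field coupling. *)
have k0 : 0 < c / (16 * d%:R) by rewrite divr_gt0// mulr_gt0.
have := field_coupling_le d_ge3 eta k0 off.
have := gradient_energy_le off.
have e0 : \sum_(x <- L) eta x * 0 = 0 by rewrite big1// => x _; rewrite mulr0.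
rewrite /energy_floor /energy e0 subr0.
have k1 : 0 <= (4 * d%:R)^-1 :> R by rewrite invr_ge0 mulr_ge0// ltW.
have := ler_wpM2l k1 hV.
have -> : (2 * (c / (16 * d%:R)))^-1 * field_flow_energy L eta = field_cost eta.
  rewrite /field_cost; field; by rewrite !gt_eqF.
have -> : (4 * d%:R)^-1 * (bond_sum L V (fun=> 0) - (d.*2 * n)%:R * v +
    c / 4 * bond_sum L (fun r => r ^+ 2) (ht phi)) =
    (4 * d%:R)^-1 * bond_sum L V (fun=> 0) -
    n%:R * (derive1 V 0 ^+ 2 / (2 * c)) +
    c / (16 * d%:R) * bond_sum L (fun r => r ^+ 2) (ht phi).
  rewrite /v -mul2n !natrM; field; by rewrite !gt_eqF.
move=> h1 /(ler_wpM2l (ltW k0)) h2 h3; move: h1 h2 h3.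
set k := c / _; lra.
Qed.

End GibbsBound.

(** * Quenched bound on the pinned fraction *)

Section PinnedFraction.
Variables (R : realType) (d : nat) (L : {fset 'rV[int]_d}).
Local Notation n := (#|` L|).
Local Notation RM := (measurableTypeR R).
Variables (V : R -> R) (c : R) (eps : {nonneg R}).
Hypothesis d_ge3 : (3 <= d)%N.
Hypothesis c_gt0 : 0 < c.
Hypothesis dV : forall t : R, derivable V t 1.
Hypothesis d2V : forall t : R, derivable (derive1 V) t 1.
Hypothesis infV : inf (range (derive1n 2 V)) = c.
Hypothesis eps_gt1 : 1 < eps%:num.
Implicit Types (phi : n.-tuple RM) (x : 'rV[int]_d) (eta : 'rV[int]_d -> R).

Local Notation ell := (ln eps%:num).
Local Notation mu := (@site_product R eps n).

Let eps_gt0 : 0 < eps%:num. Proof. exact: lt_trans eps_gt1. Qed.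
Let ell_gt0 : 0 < ell. Proof. exact: ln_gt0. Qed.

Lemma measurable_potential : measurable_fun setT V.
Proof. by apply: continuous_measurable_fun; exact: potential_continuous. Qed.

(* [e] and [h] may depend on a further parameter, so that the same lemma yields
   joint measurability in the disorder and the heights. *)
Lemma measurable_energy d' (T : measurableType d') (e h : T -> 'rV[int]_d -> R) :
  (forall x, measurable_fun setT (e ^~ x)) ->
  (forall x, measurable_fun setT (h ^~ x)) ->
  measurable_fun setT (fun w => energy L V (e w) (h w)).
Proof.
move=> me mh; apply: measurable_funB.
  apply: measurable_funM => //; apply: measurable_sum => x.
  apply: measurable_sum => y; apply: measurable_funM => //.
  apply: measurableT_comp; first exact: measurable_potential.
  exact: measurable_funB.
by apply: measurable_sum => x; exact: measurable_funM.
Qed.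

Lemma measurable_gibbs_weight eta :
  measurable_fun setT (fun phi => gibbs_weight V eta phi).
Proof.
rewrite (_ : (fun _ => _) = (fun phi => expR (- energy L V eta (ht phi)))).
  apply: measurableT_comp => //; apply: measurableT_comp => //.
  apply: measurable_energy => x //; exact: measurable_height.
by apply/funext => phi; rewrite gibbs_weightE.
Qed.

Lemma measurable_pinned x : measurable (pinned R L x).
Proof.
rewrite -[X in measurable X]setTI.
by apply: (@measurable_height R d L x measurableT [set 0]); exact: measurable_set1.
Qed.

Definition zeros phi : R := \sum_(x <- L) \1_(pinned R L x) phi.

Lemma discountE phi : discount eps phi = expR (- (ell * zeros phi)).
Proof.
rewrite /discount /zeros sum_sites mulr_sumr -sumrN expR_sum.
apply: eq_bigr => i _; rewrite indicE /pin_discount; case: eqP => [h|h].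
  rewrite mem_set ?mulr1 ?expRN ?lnK//.
  by rewrite /pinned/= -[height _ _]/(ht phi _) height_site.
rewrite memNset ?mulr0 ?oppr0 ?expR0// /pinned/= => h0; apply: h.
by rewrite -height_site.
Qed.

Lemma measurable_zeros : measurable_fun setT zeros.
Proof.
apply: measurable_sum => x; apply: measurable_indic; exact: measurable_pinned.
Qed.

Lemma zeros_ge0 phi : 0 <= zeros phi.
Proof. by apply: sumr_ge0 => x _; rewrite indicE. Qed.

Lemma zeros_le phi : zeros phi <= n%:R.
Proof.
rewrite /zeros sum_sites -[n in leRHS]card_ord -sum1_card natr_sum.
by apply: ler_sum => i _; rewrite indicE; case: (_ \in _).
Qed.

(** * Partition function and pinning for a frozen field *)

Variable eta : 'rV[int]_d -> R.
Let w phi : R := gibbs_weight V eta phi.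
Let mw : measurable_fun setT w. Proof. exact: measurable_gibbs_weight. Qed.
Let w_gt0 phi : 0 < w phi. Proof. exact: expR_gt0. Qed.
Let w_ge0 phi : 0 <= w phi. Proof. exact: expR_ge0. Qed.

Lemma gibbs_mass_indic (A : set (n.-tuple RM)) : measurable A ->
  gibbs_mass V eps eta A = (\int[mu]_phi (w phi * \1_A phi)%:E)%E.
Proof.
move=> mA; rewrite /gibbs_mass integral_mkcond; apply: eq_integral => phi _.
rewrite patchE indicE; case: (phi \in A); first by rewrite mulr1.
by rewrite mulr0.
Qed.

Let K := site_factor (convexity_const d c).

Lemma site_factor_gt0 C : 0 < site_factor C :> R.
Proof.
rewrite mulr_gt0 ?expR_gt0//; have := gauss_mass_ge0 C; lra.
Qed.

(** The left side is the partition function at strength one, written as an integral at strength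
    [eps]. *)
Lemma discounted_mass_le :
  (\int[mu]_phi (w phi * discount eps phi)%:E <=
   (K ^+ n * expR (- energy_floor L V c eta))%:E)%E.
Proof.
have := @strongly_convex_integral R eps (convexity_const d c) n
  (fun phi => energy L V eta (ht phi)) (energy_floor L V c eta)
  (convexity_const_gt0 d_ge3 c_gt0) (ltW eps_gt1).
under [in X in _ -> X]eq_integral do rewrite /w gibbs_weightE.
apply.
- by apply: measurable_energy => x //; exact: measurable_height.
- move=> s t i; exact: energy_midpoint d_ge3 c_gt0 dV d2V infV _ _ _ _.
- move=> s; exact: energy_ge d_ge3 c_gt0 dV d2V infV _ _.
Qed.

(** Only the all pinned configuration is kept; it is an atom of mass [eps ^ n]. *)
Lemma partition_function_ge :
  ((expR (- energy L V eta (fun=> 0)) * eps%:num ^+ n)%:E <=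
   partition_function L V eps eta)%E.
Proof.
pose S := [set t : n.-tuple RM | forall i, [set 0%R : RM] (tnth t i)].
have mS : measurable S.
  have -> : S = \bigcap_(i in [set: 'I_n]) ((fun t => tnth t i) @^-1` [set 0%R : RM]).
    by apply/seteqP; split => [t Bt i _|t Bt i]; [exact: Bt|exact: (Bt i I)].
  apply: fin_bigcap_measurable => // i _.
  rewrite -[X in measurable X]setTI.
  by apply: (@measurable_tnth _ RM n i) => //; exact: measurable_set1.
have muS : mu S = (eps%:num ^+ n)%:E.
  rewrite /site_product (@product_site_measureE R eps n (fun=> [set 0%R : RM]))//.
  rewrite (eq_bigr (fun=> eps%:num%:E)) => [|i _].
    by rewrite prodEFin big_const_ord iter_mulr mulr1.
  by rewrite site_measureE lebesgue_measure_set1 add0e diracE mem_set// mule1.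
rewrite /partition_function gibbs_mass_indic// EFinM -muS.
have <- : (\int[mu]_phi (expR (- energy L V eta (fun=> 0)) * \1_S phi)%:E)%E =
    ((expR (- energy L V eta (fun=> 0)))%:E * mu S)%E.
  under eq_integral do rewrite EFinM.
  rewrite ge0_integralZl//; first by rewrite integral_indic// setIT.
  by apply/measurable_EFinP; exact: measurable_indic.
apply: ge0_le_integral => //.
- by apply/measurable_EFinP; apply: measurable_funM => //; exact: measurable_indic.
- by apply/measurable_EFinP; apply: measurable_funM => //; exact: measurable_indic.
move=> phi _; rewrite lee_fin [X in _ <= _ * X]indicE mem_set// mulr1 indicE.
have [phiS|_] := boolP (phi \in S); last by rewrite mulr0.
rewrite mulr1 /w gibbs_weightE (_ : ht phi = fun=> 0)//.
apply/funext => x; have [/site_index[i ->]|xL] := boolP (x \in L).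
  by rewrite height_site; move: phiS; rewrite inE => /(_ i).
by rewrite height_off.
Qed.

(** At most [n] sites are pinned, so [eps ^ n * discount] is at least 1 and finiteness passes over
    from the discounted mass. *)
Lemma partition_function_ltey : (partition_function L V eps eta < +oo)%E.
Proof.
rewrite /partition_function gibbs_mass_indic//.
apply: (@le_lt_trans _ _
  (\int[mu]_phi ((eps%:num ^+ n)%:E * (w phi * discount eps phi)%:E))%E).
  apply: ge0_le_integral => //.
  - by move=> phi _; rewrite lee_fin mulr_ge0// indicE.
  - by apply/measurable_EFinP; apply: measurable_funM => //; exact: measurable_indic.
  - apply/measurable_EFinP; apply: measurable_funM => //.
    by apply: measurable_funM => //; exact: measurable_discount.
  move=> phi _; rewrite -EFinM lee_fin indicE mem_set// mulr1 mulrCA ler_peMr//.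
  rewrite discountE -[X in X ^+ n](lnK (x := eps%:num)) ?posrE//.
  rewrite -expRM_natl -expRD -[leLHS]expR0 ler_expR.
  by rewrite mulrC -mulrBr mulr_ge0 ?(ltW ell_gt0)// subr_ge0 zeros_le.
rewrite ge0_integralZl//.
- apply: lte_mul_pinfty => //.
  exact: le_lt_trans discounted_mass_le (ltry _).
- by apply/measurable_EFinP; apply: measurable_funM => //; exact: measurable_discount.
- by move=> phi _; rewrite lee_fin mulr_ge0 ?discount_ge0.
Qed.

Lemma partition_function_fin_num : partition_function L V eps eta \is a fin_num.
Proof.
rewrite ge0_fin_numE ?partition_function_ltey//.
by apply: integral_ge0 => phi _; rewrite lee_fin.
Qed.

Lemma partition_function_gt0 : 0 < fine (partition_function L V eps eta).
Proof.
rewrite -lte_fin fineK ?partition_function_fin_num//.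
by apply: lt_le_trans partition_function_ge; rewrite lte_fin mulr_gt0 ?expR_gt0// exprn_gt0.
Qed.

Lemma gibbs_mass_le (A : set (n.-tuple RM)) : measurable A ->
  (gibbs_mass V eps eta A <= partition_function L V eps eta)%E.
Proof.
move=> mA; rewrite /partition_function !gibbs_mass_indic//; apply: ge0_le_integral => //.
- by move=> phi _; rewrite lee_fin mulr_ge0// indicE.
- by apply/measurable_EFinP; apply: measurable_funM => //; exact: measurable_indic.
- by apply/measurable_EFinP; apply: measurable_funM => //; exact: measurable_indic.
move=> phi _; rewrite lee_fin ler_wpM2l// !indicE [in leRHS]mem_set//.
by case: (_ \in _).
Qed.

Lemma gibbs_mass_fin_num (A : set (n.-tuple RM)) : measurable A ->
  gibbs_mass V eps eta A \is a fin_num.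
Proof.
move=> mA; rewrite ge0_fin_numE; last by apply: integral_ge0 => phi _; rewrite lee_fin.
exact: le_lt_trans (gibbs_mass_le mA) partition_function_ltey.
Qed.

Lemma gibbs_le1 (A : set (n.-tuple RM)) : measurable A -> gibbs L V eps eta A <= 1.
Proof.
move=> mA; rewrite ler_pdivrMr ?partition_function_gt0// mul1r fine_le//.
- exact: gibbs_mass_fin_num.
- exact: partition_function_fin_num.
- exact: gibbs_mass_le.
Qed.

Let N : R := \sum_(x <- L) gibbs L V eps eta (pinned R L x).

Lemma gibbs_ge0 (A : set (n.-tuple RM)) : 0 <= gibbs L V eps eta A.
Proof.
by rewrite divr_ge0// fine_ge0//; apply: integral_ge0 => phi _; rewrite lee_fin.
Qed.

(* Jensen for the tilted weight: [exp (- l zeros)] lies above its tangent at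
   the Gibbs mean [N] of [zeros]. *)
Lemma partition_function_le :
  fine (partition_function L V eps eta) * expR (- (ell * N)) <=
  K ^+ n * expR (- energy_floor L V c eta).
Proof.
set Z := fine _; set b := ell * N.
have Z0 : 0 < Z by exact: partition_function_gt0.
have N0 : 0 <= N by apply: sumr_ge0 => x _; exact: gibbs_ge0.
have b0 : 0 <= b by rewrite mulr_ge0// ltW.
have ZE : (\int[mu]_phi (w phi)%:E = Z%:E)%E.
  by rewrite fineK ?partition_function_fin_num.
have NE : (\int[mu]_phi (w phi * zeros phi)%:E = (Z * N)%:E)%E.
  under eq_integral do rewrite mulr_sumr -sumEFin.
  rewrite ge0_integral_sum//; last 2 first.
  - move=> x; apply/measurable_EFinP; apply: measurable_funM => //.
    by apply: measurable_indic; exact: measurable_pinned.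
  - by move=> x phi _; rewrite lee_fin mulr_ge0// indicE.
  rewrite /N mulr_sumr -sumEFin; apply: eq_bigr => x _.
  rewrite -gibbs_mass_indic; last exact: measurable_pinned.
  rewrite /gibbs mulrC divfK ?gt_eqF// fineK//.
  by apply: gibbs_mass_fin_num; exact: measurable_pinned.
have /= h := discounted_mass_le.
(* The integrated tangent inequality, with its negative term moved to the other side so that all
   integrands are nonnegative. *)
have : ((expR (- b) * (1 + b))%:E * \int[mu]_phi (w phi)%:E <=
    \int[mu]_phi (w phi * discount eps phi)%:E +
    (expR (- b) * ell)%:E * \int[mu]_phi (w phi * zeros phi)%:E)%E.
  rewrite -!ge0_integralZl//; first last.
  - by rewrite lee_fin mulr_ge0 ?expR_ge0// addr_ge0.
  - by move=> phi _; rewrite lee_fin.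
  - exact/measurable_EFinP.
  - by rewrite lee_fin mulr_ge0 ?expR_ge0// ltW.
  - by move=> phi _; rewrite lee_fin mulr_ge0// zeros_ge0.
  - by apply/measurable_EFinP; apply: measurable_funM => //; exact: measurable_zeros.
  rewrite -ge0_integralD//; first last.
  - apply/measurable_EFinP; apply: measurable_funM => //.
    by apply: measurable_funM => //; exact: measurable_zeros.
  - move=> phi _; rewrite -EFinM lee_fin !mulr_ge0 ?expR_ge0 ?zeros_ge0//.
    exact: ltW.
  - by apply/measurable_EFinP; apply: measurable_funM => //; exact: measurable_discount.
  - by move=> phi _; rewrite lee_fin mulr_ge0 ?discount_ge0.
  apply: ge0_le_integral => //.
  - by move=> phi _; rewrite -EFinM lee_fin !mulr_ge0 ?expR_ge0 ?addr_ge0.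
  - by apply/measurable_EFinP; exact: measurable_funM.
  - apply/measurable_EFinP; apply: measurable_funD.
      by apply: measurable_funM => //; exact: measurable_discount.
    apply: measurable_funM => //.
    by apply: measurable_funM => //; exact: measurable_zeros.
  move=> phi _; rewrite -!EFinM -EFinD lee_fin discountE.
  have -> : - (ell * zeros phi) = - b + (b - ell * zeros phi) by ring.
  rewrite expRD; have := expR_ge1Dx (b - ell * zeros phi).
  move=> /(ler_wpM2l (expR_ge0 (- b))) /(ler_wpM2l (w_ge0 phi)); lra.
rewrite ZE NE => h2; have {h h2} := le_trans h2 (leeD2r _ h).
rewrite -!EFinM -EFinD lee_fin.
have -> : expR (- b) * ell * (Z * N) = expR (- b) * b * Z by rewrite /b; ring.
lra.
Qed.

(** Taking logarithms of the lower and upper bounds, the energy of the zero profile cancels;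
    dividing by [ell > 0] concludes. *)
Lemma pinned_sum_ge :
  n%:R <= N + n%:R * ((ln K + derive1 V 0 ^+ 2 / (2 * c)) / ell) +
          field_cost L c eta / ell.
Proof.
have h1 := partition_function_ge.
rewrite -[leRHS]fineK ?partition_function_fin_num// lee_fin in h1.
have := le_trans (ler_wpM2r (expR_ge0 (- (ell * N))) h1) partition_function_le.
have -> : eps%:num ^+ n = expR (n%:R * ell) by rewrite expRM_natl lnK.
have -> : K ^+ n = expR (n%:R * ln K) by rewrite expRM_natl lnK// posrE site_factor_gt0.
rewrite -!expRD ler_expR /energy_floor.
set v := _ / (2 * c); set X := field_cost _ _ _; set e0 := energy _ _ _ _ => h.
have : n%:R * ell <= ell * N + n%:R * (ln K + v) + X by lra.
rewrite -ler_pdivlMr// => /le_trans; apply.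
rewrite le_eqVlt; apply/orP; left; apply/eqP; field.
by rewrite gt_eqF.
Qed.

End PinnedFraction.

(** * Orthogonality of the fields *)

Section Orthogonality.
Context {dO : measure_display} {Omega : measurableType dO} {R : realType}.
Context {P : probability Omega R} {I : choiceType}.
Variable X : I -> {RV P >-> R}.
Hypothesis indepX : mutually_independent X.
Hypothesis identX : identically_distributed X.
Hypothesis symX : symmetrically_distributed X.

Let mX i : measurable_fun setT (X i). Proof. exact: measurable_funPT. Qed.

Lemma second_moment_eq i j :
  (\int[P]_w ((X i w) ^+ 2)%:E = \int[P]_w ((X j w) ^+ 2)%:E)%E.
Proof.
have h k : (\int[P]_w ((X k w) ^+ 2)%:E =
    \int[distribution P (X k)]_r (r ^+ 2)%:E)%E.
  rewrite /distribution ge0_integral_pushforward//.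
  - by apply/measurable_EFinP; exact: measurable_funX.
  - by move=> r _; rewrite lee_fin sqr_ge0.
by rewrite !h; apply: eq_measure_integral => A mA _; exact: identX.
Qed.

Variable s2 : R.
Hypothesis s2E : forall i, (\int[P]_w ((X i w) ^+ 2)%:E = s2%:E)%E.

Lemma integrable_sqr i : P.-integrable setT (fun w => ((X i w) ^+ 2)%:E).
Proof.
apply/integrableP; split; first by apply/measurable_EFinP; exact: measurable_funX.
under eq_integral do rewrite gee0_abs ?lee_fin ?sqr_ge0//.
by rewrite s2E ltry.
Qed.

Lemma integrable_product i j : P.-integrable setT (fun w => (X i w * X j w)%:E).
Proof.
apply: le_integrable (integrableD measurableT (integrable_sqr i) (integrable_sqr j)) => //.
  by apply/measurable_EFinP; exact: measurable_funM.
move=> w _; rewrite lee_fin [leRHS]ger0_norm ?addr_ge0 ?sqr_ge0// normrM.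
rewrite -[X in _ <= X + _]real_normK ?num_real// -[X in _ <= _ + X]real_normK ?num_real//.
have := sqr_ge0 (`|X i w| - `|X j w|); have := sqr_ge0 (`|X i w| + `|X j w|).
rewrite sqrrB sqrrD; set a := `|_|; set b := `|X j w|; lra.
Qed.

(** For a law-preserving [g], independence on rectangles makes the product law that of [g (X i)] and
    [X j]. The identity and the sign change thus give the same integral. *)
Lemma integral_joint i j (g : R -> R) : i != j -> measurable_fun setT g ->
  (forall A : set R, measurable A ->
     distribution P (X i) (g @^-1` A) = distribution P (X i) A) ->
  P.-integrable setT (fun w => (g (X i w) * X j w)%:E) ->
  (\int[P]_w (g (X i w) * X j w)%:E =
   \int[(distribution P (X i) \x distribution P (X j))%E]_z (z.1 * z.2)%:E)%E.
Proof.
move=> ij mg gE intg.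
pose J w := (g (X i w), X j w).
have mJ : measurable_fun setT J.
  by apply/measurable_fun_pair => //; exact: measurableT_comp.
pose F (z : R * R) := (z.1 * z.2)%:E.
have mF : measurable_fun setT F.
  by apply/measurable_EFinP; exact: measurable_funM.
transitivity (\int[pushforward P J]_z F z)%E.
  by rewrite integral_pushforward.
apply: eq_measure_integral => A mA _; apply/esym.
apply: (@product_measure_unique _ _ _ _ _ (distribution P (X i)) (distribution P (X j))
  (measure_function_pushforward__canonical__measure_function_Measure P mJ)) => // B C mB mC.
rewrite -[RHS]/(distribution P (X i) B * distribution P (X j) C)%E -gE//.
(* Independence takes a family indexed by all of [I]: the preimage of [B] sits at [i], and [C]
   everywhere else, in particular at [j]. *)
pose D k := if k == i then g @^-1` B else C.
have mD k : measurable (D k).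
  by rewrite /D; case: ifP => // _; rewrite -[X in measurable X]setTI; exact: mg.
have Di : D i = g @^-1` B by rewrite /D eqxx.
have Dj : D j = C by rewrite /D eq_sym (negbTE ij).
have := indepX [fset i; j]%fset mD.
rewrite big_fsetU1 ?inE// big_seq_fset1 Di Dj => e.
rewrite -[RHS]e; congr (P _); apply/seteqP; split => [w [/= wB wC] k|w h].
  by rewrite /= !inE => /orP[/eqP ->|/eqP ->]; rewrite ?Di ?Dj.
split.
  by have := h i; rewrite /= !inE eqxx Di => /(_ isT).
by have := h j; rewrite /= !inE eqxx orbT Dj => /(_ isT).
Qed.

(** By symmetry the integral equals its own negative; being finite, it vanishes. *)
Lemma integral_product_eq0 i j : i != j -> (\int[P]_w (X i w * X j w)%:E = 0)%E.
Proof.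
move=> ij; have int1 := integrable_product i j.
have int2 : P.-integrable setT (fun w => (- X i w * X j w)%:E).
  have := integrableZl measurableT (-1) int1; apply: eq_integrable => // w _.
  by rewrite -EFinM mulN1r mulNr.
have e1 := integral_joint ij (@measurable_id _ _ _) (fun _ _ => erefl) int1.
have mN : measurable_fun setT (-%R : R -> R) by exact: oppr_measurable.
have e2 := integral_joint ij mN (symX i) int2.
have : (\int[P]_w (- X i w * X j w)%:E = (-1)%:E * \int[P]_w (X i w * X j w)%:E)%E.
  rewrite -integralZl//; apply: eq_integral => w _.
  by rewrite -EFinM mulN1r mulNr.
rewrite e2 -e1.
have := integrable_fin_num measurableT int1.
case: (\int[P]_w _)%E => // r _; rewrite -EFinM => -[] h; congr (_%:E); lra.
Qed.

Lemma second_moment_sum (L : {fset I}) (a : I -> R) :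
  (\int[P]_w ((\sum_(x <- L) X x w * a x) ^+ 2)%:E =
   (s2 * \sum_(x <- L) a x ^+ 2)%:E)%E.
Proof.
have -> : (\int[P]_w ((\sum_(x <- L) X x w * a x) ^+ 2)%:E =
    \int[P]_w \sum_(x <- L) \sum_(y <- L) ((a x * a y)%:E * (X x w * X y w)%:E))%E.
  apply: eq_integral => w _; rewrite expr2 mulr_suml -sumEFin; apply: eq_bigr => x _.
  rewrite mulr_sumr -sumEFin; apply: eq_bigr => y _.
  by rewrite -EFinM; congr (_%:E); ring.
have int2 x y : P.-integrable setT (fun w => (a x * a y)%:E * (X x w * X y w)%:E)%E.
  by apply: integrableZl => //; exact: integrable_product.
rewrite integral_sum//; last by move=> x; apply: integrable_sum.
rewrite mulr_sumr -sumEFin big_seq [RHS]big_seq; apply: eq_bigr => x xL.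
rewrite integral_sum// (big_fsetD1 x)//= big_seq big1 ?adde0.
  rewrite integralZl//; last exact: integrable_product.
  under eq_integral do rewrite -expr2.
  by rewrite s2E -EFinM mulrC -expr2.
move=> y; rewrite !inE => /andP[yx _].
rewrite integralZl//; last exact: integrable_product.
by rewrite integral_product_eq0 ?mule0// eq_sym.
Qed.

End Orthogonality.

(** * Disorder average *)

Section DisorderAverage.
Context {dO : measure_display} {Omega : measurableType dO} {R : realType}.
Context {P : probability Omega R} {d : nat}.
Variables (eta : 'rV[int]_d -> {RV P >-> R}) (L : {fset 'rV[int]_d}).
Hypothesis d_ge3 : (3 <= d)%N.
Local Notation n := (#|` L|).
Local Notation RM := (measurableTypeR R).

Let field w x : R := eta x w.

Let meta x : measurable_fun setT (field ^~ x). Proof. exact: measurable_funPT. Qed.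

Lemma measurable_field_cost (c : R) :
  measurable_fun setT (fun w => field_cost L c (field w)).
Proof.
apply: measurable_funM => //; apply: measurable_sum => z; apply: measurable_sum => k.
by apply: measurable_funX; apply: measurable_sum => x; exact: measurable_funM.
Qed.

Lemma field_cost_ge0 (c : R) (e : 'rV[int]_d -> R) : 0 < c -> 0 <= field_cost L c e.
Proof.
move=> c0; rewrite mulr_ge0 ?divr_ge0 ?mulr_ge0//; first exact: ltW.
by apply: sumr_ge0 => z _; apply: sumr_ge0 => k _; exact: sqr_ge0.
Qed.

(** Orthogonality splits the squared superposition site by site, and each site contributes a flow
    energy of at most 2, turning [8 d / c] into [16 d / c]. *)
Lemma integral_field_cost_le (c s2 : R) : 0 < c ->
  mutually_independent eta -> symmetrically_distributed eta ->
  (forall x, (\int[P]_w ((eta x w) ^+ 2)%:E = s2%:E)%E) ->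
  (\int[P]_w (field_cost L c (field w))%:E <= (n%:R * (16 * d%:R / c * s2))%:E)%E.
Proof.
move=> c0 indep sym s2E.
have d_gt0 : (0 < d)%N by exact: leq_trans d_ge3.
have s20 : 0 <= s2.
  by rewrite -lee_fin -(s2E 0); apply: integral_ge0 => w _; rewrite lee_fin sqr_ge0.
have k0 : 0 <= 8 * d%:R / c by rewrite divr_ge0 ?mulr_ge0// ltW.
have mS z k : measurable_fun setT
    (fun w => (\sum_(x <- L) field w x * flow R (z - x) k) ^+ 2).
  by apply: measurable_funX; apply: measurable_sum => x; exact: measurable_funM.
have mSS z : measurable_fun setT
    (fun w => \sum_k (\sum_(x <- L) field w x * flow R (z - x) k) ^+ 2).
  exact: measurable_sum.
rewrite /field_cost; under eq_integral do rewrite EFinM.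
rewrite ge0_integralZl//; last 2 first.
- by apply/measurable_EFinP; exact: measurable_sum.
- move=> w _; rewrite lee_fin; apply: sumr_ge0 => z _.
  by apply: sumr_ge0 => k _; exact: sqr_ge0.
have -> : (\int[P]_w (field_flow_energy L (field w))%:E =
    (\sum_(z <- edge_base L) \sum_k
      s2 * \sum_(x <- L) flow R (z - x) k ^+ 2)%:E)%E.
  rewrite /field_flow_energy; under eq_integral do rewrite -sumEFin.
  rewrite ge0_integral_sum//; last 2 first.
  - by move=> z; exact/measurable_EFinP.
  - by move=> z w _; rewrite lee_fin; apply: sumr_ge0 => k _; exact: sqr_ge0.
  rewrite -sumEFin; apply: eq_bigr => z _.
  under eq_integral do rewrite -sumEFin.
  rewrite ge0_integral_sum//; last 2 first.
  - by move=> k; exact/measurable_EFinP.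
  - by move=> k w _; rewrite lee_fin sqr_ge0.
  rewrite -sumEFin; apply: eq_bigr => k _.
  exact: second_moment_sum indep sym s2 s2E L _.
rewrite -EFinM lee_fin.
under eq_bigr do rewrite -mulr_sumr exchange_big/=.
rewrite -mulr_sumr exchange_big/=.
have : \sum_(x <- L) \sum_(z <- edge_base L) \sum_k flow R (z - x) k ^+ 2 <= n%:R * 2.
  apply: (@le_trans _ _ (\sum_(x <- L) (2 : R))).
    by apply: ler_sum => x _; exact: flow_energy.
  by rewrite big_const_seq count_predT iter_addr addr0 -[leLHS]mulr_natl.
move=> /(ler_wpM2l s20) /(ler_wpM2l k0) /le_trans; apply.
by rewrite le_eqVlt; apply/orP; left; apply/eqP; field; rewrite gt_eqF.
Qed.

(** * Measurability in the disorder and the averaged bound *)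

Variables (V : R -> R) (c : R) (eps : {nonneg R}).
Hypothesis c_gt0 : 0 < c.
Hypothesis dV : forall t : R, derivable V t 1.
Hypothesis d2V : forall t : R, derivable (derive1 V) t 1.
Hypothesis infV : inf (range (derive1n 2 V)) = c.
Hypothesis eps_gt1 : 1 < eps%:num.

(** Tonelli: a partial integral of a nonnegative function jointly measurable in disorder and
    heights. *)
Lemma measurable_gibbs_mass (A : set (n.-tuple RM)) : measurable A ->
  measurable_fun setT (fun w => gibbs_mass V eps (field w) A).
Proof.
move=> mA.
rewrite (_ : (fun w => _) = fubini_F (site_product eps (n:=n))
  (fun z : Omega * n.-tuple RM =>
    (expR (- energy L V (field z.1) (ht z.2)) * \1_A z.2)%:E)).
  apply: measurable_fun_fubini_tonelli_F.
    apply/measurable_EFinP; apply: measurable_funM.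
      apply: measurableT_comp => //; apply: measurableT_comp => //.
      apply: (@measurable_energy R d L V dV _ _ (fun z => field z.1) (fun z => ht z.2)) => x.
        exact: (measurableT_comp (meta x)).
      exact: (measurableT_comp (measurable_height x)).
    have m1A : measurable_fun setT (\1_A : n.-tuple RM -> R) by exact: measurable_indic.
    exact: (measurableT_comp m1A).
  by move=> z; rewrite lee_fin mulr_ge0 ?expR_ge0// indicE.
apply/funext => w; rewrite gibbs_mass_indic//.
by apply: eq_integral => phi _; rewrite gibbs_weightE.
Qed.

(* [1 / Z = exp (- ln Z)] since [Z > 0]. *)
Lemma measurable_gibbs (A : set (n.-tuple RM)) : measurable A ->
  measurable_fun setT (fun w => gibbs L V eps (field w) A).
Proof.
move=> mA; rewrite (_ : (fun w => _) = (fun w => fine (gibbs_mass V eps (field w) A) *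
    expR (- ln (fine (partition_function L V eps (field w)))))).
  apply: measurable_funM.
    by apply: measurableT_comp => //; exact: measurable_gibbs_mass.
  do 2 apply: measurableT_comp => //.
  apply: (measurableT_comp (@measurable_ln R)).
  by apply: measurableT_comp => //; exact: measurable_gibbs_mass.
apply/funext => w; rewrite /gibbs expRN lnK// posrE.
exact: partition_function_gt0 d_ge3 c_gt0 dV d2V infV eps_gt1 _.
Qed.

(** The quenched bound is integrated over the disorder; its terms are nonnegative, so the integral
    splits and the mean field cost can be bounded separately. *)
Lemma expected_pinned_sum_ge (s2 : R) :
  mutually_independent eta -> symmetrically_distributed eta ->
  (forall x, (\int[P]_w ((eta x w) ^+ 2)%:E = s2%:E)%E) ->
  n%:R <= \sum_(x <- L) fine ('E_P[fun w => gibbs L V eps (field w) (pinned R L x)])%E +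
    n%:R * ((ln (site_factor (convexity_const d c)) + derive1 V 0 ^+ 2 / (2 * c)
             + 16 * d%:R / c * s2) / ln eps%:num).
Proof.
move=> indep sym s2E; set ell := ln eps%:num; set C1 := ln _ + _.
have ell0 : 0 < ell by exact: ln_gt0.
pose g x w : R := gibbs L V eps (field w) (pinned R L x).
have mg x : measurable_fun setT (g x).
  by apply: measurable_gibbs; exact: measurable_pinned.
have g0 x w : 0 <= g x w by rewrite /g; exact: gibbs_ge0.
(* Gibbs probabilities are at most 1, so the expectations are finite and [fine] loses nothing. *)
have Efin x : ('E_P[g x])%E \is a fin_num.
  rewrite unlock ge0_fin_numE; last by apply: integral_ge0 => w _; rewrite lee_fin.
  apply: (@le_lt_trans _ _ (\int[P]_w (1%R)%:E)%E); last first.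
    by rewrite integral_cst//= probability_setT mule1 ltry.
  apply: ge0_le_integral => //; first by move=> w _; rewrite lee_fin.
    exact/measurable_EFinP.
  move=> w _; rewrite lee_fin.
  apply: (gibbs_le1 d_ge3 c_gt0 dV d2V infV eps_gt1).
  exact: measurable_pinned.
have C10 : 0 <= C1.
  apply: addr_ge0; last by rewrite divr_ge0 ?sqr_ge0// mulr_ge0// ltW.
  rewrite ln_ge0// /site_factor.
  have := expR_ge1Dx (1 : R); have := gauss_mass_ge0 (convexity_const d c : R); nra.
pose Y w := \sum_(x <- L) g x w + (n%:R * (C1 / ell) + ell^-1 * field_cost L c (field w)).
have mY : measurable_fun setT (fun w => n%:R * (C1 / ell) + ell^-1 * field_cost L c (field w)).
  by apply: measurable_funD => //; apply: measurable_funM => //; exact: measurable_field_cost.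
have k0 : 0 <= n%:R * (C1 / ell) by rewrite mulr_ge0// divr_ge0// ltW.
have i0 : 0 <= ell^-1 by rewrite invr_ge0 ltW.
have X0 w : 0 <= ell^-1 * field_cost L c (field w) by rewrite mulr_ge0// field_cost_ge0.
have : ((n%:R)%:E <= \int[P]_w (Y w)%:E)%E.
  have -> : ((n%:R)%:E = \int[P]_w (n%:R : R)%:E)%E.
    by rewrite integral_cst//= probability_setT mule1.
  apply: ge0_le_integral => //.
    by apply/measurable_EFinP; apply: measurable_funD => //; exact: measurable_sum.
  move=> w _; rewrite lee_fin /Y.
  have := pinned_sum_ge L d_ge3 c_gt0 dV d2V infV eps_gt1 (field w).
  by rewrite addrA [ell^-1 * _]mulrC.
have -> : (\int[P]_w (Y w)%:E = \sum_(x <- L) 'E_P[g x] +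
    ((n%:R * (C1 / ell))%:E +
     (ell^-1)%:E * \int[P]_w (field_cost L c (field w))%:E))%E.
  rewrite /Y; under eq_integral do rewrite EFinD.
  rewrite ge0_integralD//; last 4 first.
  - by move=> w _; rewrite lee_fin; apply: sumr_ge0.
  - by apply/measurable_EFinP; exact: measurable_sum.
  - by move=> w _; rewrite lee_fin addr_ge0.
  - exact/measurable_EFinP.
  congr (_ + _)%E.
    under eq_integral do rewrite -sumEFin.
    rewrite ge0_integral_sum//.
    - by apply: eq_bigr => x _; rewrite unlock.
    - by move=> x; exact/measurable_EFinP.
    - by move=> x w _; rewrite lee_fin.
  under eq_integral do rewrite EFinD.
  rewrite ge0_integralD//; last 2 first.
  - by move=> w _; rewrite lee_fin.
  - by apply/measurable_EFinP; apply: measurable_funM => //; exact: measurable_field_cost.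
  congr (_ + _)%E; first by rewrite integral_cst//= probability_setT mule1.
  under eq_integral do rewrite EFinM.
  rewrite ge0_integralZl//.
  - by apply/measurable_EFinP; exact: measurable_field_cost.
  - by move=> w _; rewrite lee_fin field_cost_ge0.
move=> h; have {}h := le_trans h (leeD2l _ (leeD2l _ (lee_wpmul2l _
  (integral_field_cost_le c_gt0 indep sym s2E)))).
have {}h : ((n%:R)%:E <= \sum_(x <- L) 'E_P[g x] + ((n%:R * (C1 / ell))%:E +
   (ell^-1)%:E * (n%:R * (16 * d%:R / c * s2))%:E))%E.
  by apply: h; rewrite lee_fin.
rewrite (eq_bigr (fun x => (fine 'E_P[g x])%:E%E)) in h; last by move=> x _; rewrite fineK.
rewrite sumEFin -EFinM -!EFinD lee_fin in h.
apply: le_trans h _; rewrite le_eqVlt; apply/orP; left; apply/eqP; congr (_ + _).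
by field; rewrite !gt_eqF.
Qed.

End DisorderAverage.

(** * Volume average, with constants fixed before the potential and the disorder *)

Theorem theorem1p4 (R : realType) (d : nat) (hd : (3 <= d)%N)
    (c_minus v1 : R) (hc : 0 < c_minus) :
  exists C1 C2 : R, 0 < C1 /\ 0 < C2 /\
    forall V : R -> R,
      (forall t : R, derivable V t 1) ->
      (forall t : R, derivable (derive1 V) t 1) ->
      inf (range (derive1n 2 V)) = c_minus ->
      derive1 V 0 = v1 ->
    forall (dO : measure_display) (Omega : measurableType dO)
      (P : probability Omega R) (eta : 'rV[int]_d -> {RV P >-> R}),
      mutually_independent eta ->
      identically_distributed eta ->
      symmetrically_distributed eta ->
      ('E_P[fun w => (eta 0 w ^+ 2)%R] < +oo)%E ->
    forall (eps : {nonneg R}) (L : {fset 'rV[int]_d}),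
      1 < eps%:num -> L != fset0%fset ->
      (#|` L|%:R)^-1 *
        \sum_(x <- L)
          fine ('E_P[fun w => gibbs L V eps (fun y => eta y w) (pinned R L x)])%E
      >= 1 - (C1 + C2 * fine ('E_P[fun w => (eta 0 w ^+ 2)%R])%E) / ln eps%:num.
Proof.
(* The logarithmic cost of integrating out a site plus its slope cost; [V] enters only through
   [c_minus] and [v1]. *)
exists (ln (site_factor (convexity_const d c_minus)) + v1 ^+ 2 / (2 * c_minus)).
(* The prefactor of [field_cost] times the bound 2 on the energy of one flow. *)
exists (16 * d%:R / c_minus).
have d0 : 0 < d%:R :> R by rewrite ltr0n; exact: leq_trans hd.
split.
  apply: ltr_pwDl; last by rewrite divr_ge0 ?sqr_ge0// mulr_ge0// ltW.
  rewrite ln_gt0// /site_factor.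
  have := expR_ge1Dx (1 : R).
  have := gauss_mass_ge0 (convexity_const d c_minus : R); nra.
split; first by rewrite divr_gt0// mulr_gt0.
move=> V dV d2V infV <- dO Omega P eta indep ident sym fin2 eps L eps1 L0.
have n0 : 0 < #|` L|%:R :> R by rewrite ltr0n cardfs_gt0.
set s2 := fine _.
(* Identical distribution gives every site the finite second moment of [eta 0]. *)
have s2E x : (\int[P]_w ((eta x w) ^+ 2)%:E = s2%:E)%E.
  rewrite (second_moment_eq ident x 0) /s2 unlock fineK//.
  rewrite unlock in fin2; rewrite ge0_fin_numE//.
  by apply: integral_ge0 => w _; rewrite lee_fin sqr_ge0.
have := expected_pinned_sum_ge L hd hc dV d2V infV eps1 indep sym s2E.
rewrite -lerBlDr -[X in X - _]mulr1 -mulrBr.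
by move=> /(ler_wpM2l (ltW (_ : 0 < (#|` L|%:R)^-1)));
  rewrite invr_gt0 n0 => /(_ isT); rewrite mulKf ?gt_eqF.
Qed.
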